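(* Let $\{\alpha_n\}_{n\in\mathbb{N}}\subset(0,d)$ be such that $\alpha_n\to 0^+$ as $n\to+\infty$. Then the following hold. (i) (Compactness) Let $\{u^n\}_{n\in\mathbb{N}}\subset L^2(\Omega)$ be such that $$\widehat{\mathcal{J}}^{\alpha_n}(u^n)+(|\Omega|+m)\|u^n\|^2_{L^2(\Omega)}\le M$$ for some constants $m,M>0$ independent of $n$. Then, up to a subsequence, $u^n\to u$ strongly in $L^2(\Omega)$ for some $u\in H^0_0(\Omega)$. (ii) ($\Gamma$-liminf inequality) For every $u\in H^0_0(\Omega)$ and for every $\{u^n\}_{n\in\mathbb{N}}\subset L^2(\Omega)$ with $u^n\to u$ in $L^2(\Omega)$, it holds $$\widehat{\mathcal{J}}^0(u)\le\liminf_{n\to+\infty}\widehat{\mathcal{J}}^{\alpha_n}(u^n).$$ (iii) ($\Gamma$-limsup inequality) For every $u\in H^0_0(\Omega)$ there exists $\{u^n\}_{n\in\mathbb{N}}\subset L^2(\Omega)$ with $u^n\to u$ in $L^2(\Omega)$ such that $$\widehat{\mathcal{J}}^0(u)=\lim_{n\to+\infty}\widehat{\mathcal{J}}^{\alpha_n}(u^n).$$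
   Context: Let $d\in\mathbb{N}$ (with $d\ge 1$) and let $\Omega\subset\mathbb{R}^d$ be a bounded open set with Lipschitz continuous boundary; $|\Omega|$ is its Lebesgue measure. $L^2(\Omega)$ is the space of real-valued square-integrable functions, and $\omega_d$ is the Lebesgue measure of the unit ball of $\mathbb{R}^d$. For $u\in L^2(\Omega)$, $\tilde u\in L^2(\mathbb{R}^d)$ denotes the extension of $u$ by $0$ outside $\Omega$. For $\alpha\in(0,d)$ and $u\in L^2(\Omega)$ set $$\mathcal{J}^\alpha(u):=-\int_\Omega\int_\Omega\frac{u(x)u(y)}{|x-y|^{d-\alpha}}\,dy\,dx,\qquad \widehat{\mathcal{J}}^\alpha(u):=\mathcal{J}^\alpha(u)+\frac{d\omega_d}{\alpha}\|u\|^2_{L^2(\Omega)}.$$ Let $\mathcal{D}_1:=\{(x,y)\in\mathbb{R}^d\times\mathbb{R}^d:|x-y|\le1\}$. For $u\in L^2(\Omega)$ set $$\mathcal{G}^0_1(u):=\frac12\iint_{\mathcal{D}_1}\frac{|\tilde u(x)-\tilde u(y)|^2}{|x-y|^{d}}\,dy\,dx\in[0,+\infty],\qquad \mathcal{J}^0_1(u):=-\iint_{(\Omega\times\Omega)\setminus\mathcal{D}_1}\frac{u(x)u(y)}{|x-y|^{d}}\,dy\,dx\in\mathbb{R},$$ $$\widehat{\mathcal{J}}^0(u):=\mathcal{G}^0_1(u)+\mathcal{J}^0_1(u)\in(-\infty,+\infty],\qquad H^0_0(\Omega):=\{u\in L^2(\Omega):\mathcal{G}^0_1(u)<+\infty\}.$$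 *)

(* Defs.v *)
From HB Require Import structures.
From mathcomp Require Import all_boot all_order all_algebra.
From mathcomp Require Import all_classical all_reals all_analysis.

Set Implicit Arguments.
Unset Strict Implicit.
Unset Printing Implicit Defensive.

Import Order.TTheory GRing.Theory Num.Theory.
Import numFieldNormedType.Exports.

Local Open Scope classical_set_scope.
Local Open Scope ring_scope.

(* 'rV[T]_n carries the sigma-algebra generated by the coordinate maps; for
   T = R this is the Borel sigma-algebra of R^n. *)
Definition measure_row_display : measure_display -> measure_display.
Proof. exact. Qed.

Section measurable_row.
Context {disp} {T : measurableType disp}.
Variable n : nat.

Let coords : 'I_n -> 'rV[T]_n -> T := fun i x => x ord0 i.

Let row_set0 : g_sigma_preimage coords set0.
Proof. exact: sigma_algebra0. Qed.

Let row_setC A : g_sigma_preimage coords A -> g_sigma_preimage coords (~` A).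
Proof. exact: sigma_algebraC. Qed.

Let row_bigcup (F : (set 'rV[T]_n)^nat) :
  (forall i, g_sigma_preimage coords (F i)) ->
  g_sigma_preimage coords (\bigcup_i (F i)).
Proof. exact: sigma_algebra_bigcup. Qed.

HB.instance Definition _ := @isMeasurable.Build (measure_row_display disp)
  'rV[T]_n (g_sigma_preimage coords) row_set0 row_setC row_bigcup.

End measurable_row.

Lemma measurable_coord disp (T : measurableType disp) n (i : 'I_n) :
  measurable_fun [set: 'rV[T]_n] (fun x : 'rV[T]_n => x ord0 i).
Proof.
move=> _ Y mY; rewrite setTI; apply: sub_sigma_algebra => /=.
rewrite -bigcup_seq/=; exists i => /=; first by rewrite mem_index_enum.
by exists Y => //; rewrite setTI.
Qed.

Lemma measurable_fun_row d1 d2 (T1 : measurableType d1)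
    (T2 : measurableType d2) n (f : T1 -> 'rV[T2]_n) :
  (forall i, measurable_fun [set: T1] (fun x => f x ord0 i)) ->
  measurable_fun [set: T1] f.
Proof.
move=> mf _ Y mY; rewrite setTI.
have [sF bF] : sigma_algebra [set: 'rV[T2]_n]
    [set A : set 'rV[T2]_n | measurable (f @^-1` A)] /\
    \big[setU/set0]_(i < n) preimage_set_system setT
      (fun x : 'rV[T2]_n => x ord0 i) measurable `<=`
      [set A : set 'rV[T2]_n | measurable (f @^-1` A)].
  split.
    split=> /=.
    - by rewrite preimage_set0.
    - by move=> A mA; rewrite setTD preimage_setC; exact: measurableC.
    - move=> F mF; rewrite preimage_bigcup; exact: bigcup_measurable.
  rewrite -bigcup_seq; apply: bigcup_sub => i _ _ [A mA <-] /=.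
  by have := mf i measurableT A mA; rewrite !setTI.
exact: (smallest_sub sF bF).
Qed.

Section lebesgue_measure_row.
Context {R : realType}.

Definition cons_row n (p : measurableTypeR R * 'rV[R]_n) : 'rV[R]_n.+1 :=
  row_mx (const_mx p.1 : 'rV_1) p.2.

Definition uncons_row n (v : 'rV[R]_n.+1) :
    measurableTypeR R * 'rV[R]_n :=
  (v ord0 ord0, rsubmx (v : 'rV_(1 + n))).

Lemma cons_rowK n : cancel (@cons_row n) (@uncons_row n).
Proof.
move=> [a v]; rewrite /uncons_row /cons_row row_mxKr/=; congr pair.
have -> : (ord0 : 'I_n.+1) = lshift n (ord0 : 'I_1) by exact/val_inj.
by rewrite (@row_mxEl _ 1 1 n) mxE.
Qed.

Lemma measurable_cons_row n : measurable_fun setT (@cons_row n).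
Proof.
apply: measurable_fun_row => i; rewrite /cons_row.
case: (split_ordP (i : 'I_(1 + n))) => j ->.
  rewrite (_ : (fun _ => _) = fst); first exact: measurable_fst.
  by apply/funext => -[a v]; rewrite (@row_mxEl _ 1 1 n) mxE.
rewrite (_ : (fun _ => _) = (fun v : 'rV[R]_n => v ord0 j) \o snd).
  by apply: measurableT_comp => //; exact: measurable_coord.
by apply/funext => -[a v] /=; rewrite (@row_mxEr _ 1 1 n).
Qed.

Lemma measurable_uncons_row n : measurable_fun setT (@uncons_row n).
Proof.
apply: measurable_fun_pair; first exact: measurable_coord.
apply: measurable_fun_row => i /=.
rewrite (_ : (fun _ => _) = fun v : 'rV[R]_n.+1 => v ord0 (rshift 1 i)).
  exact: measurable_coord.
by apply/funext => v; rewrite mxE.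
Qed.

Section step.
Variables (n : nat) (mu : {sigma_finite_measure set 'rV[R]_n -> \bar R}).

Definition lebesgue_row_step : set 'rV[R]_n.+1 -> \bar R :=
  pushforward (@lebesgue_measure R \x mu)%E (@cons_row n).

Let step0 : lebesgue_row_step set0 = 0%E.
Proof. by rewrite /lebesgue_row_step /pushforward preimage_set0 measure0. Qed.

Let step_ge0 A : (0 <= lebesgue_row_step A)%E.
Proof. by rewrite /lebesgue_row_step /pushforward; exact: measure_ge0. Qed.

Let step_sigma_additive : semi_sigma_additive lebesgue_row_step.
Proof.
move=> F mF tF mUF; rewrite /lebesgue_row_step /pushforward preimage_bigcup.
apply: measure_semi_sigma_additive.
- by move=> i; rewrite -[X in measurable X]setTI; exact: measurable_cons_row.
- apply/trivIsetP => /= i j _ _ ij; rewrite -preimage_setI.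
  by move/trivIsetP : tF => /(_ _ _ _ _ ij) ->//; rewrite preimage_set0.
- rewrite -preimage_bigcup -[X in measurable X]setTI.
  exact: measurable_cons_row.
Qed.

HB.instance Definition _ := isMeasure.Build _ _ _ lebesgue_row_step
  step0 step_ge0 step_sigma_additive.

Let step_sigma_finite : sigma_finite setT lebesgue_row_step.
Proof.
have [F FT Ffin] : sigma_finite setT (@lebesgue_measure R \x mu)%E.
  have /sigma_finiteP[F [TF ndF Foo]] := sigma_finiteT (@lebesgue_measure R).
  have /sigma_finiteP[G [TG ndG Goo]] := sigma_finiteT mu.
  exists (fun i => F i `*` G i).
    rewrite -setXTT TF TG predeqE => -[x y]; split.
      move=> [/= [i _ Fix] [k _ Gky]]; exists (maxn i k) => //; split.
      - by move: x Fix; exact/subsetPset/ndF/leq_maxl.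
      - by move: y Gky; exact/subsetPset/ndG/leq_maxr.
    by move=> [i _ []/= ? ?]; split; exists i.
  move=> k; have [? ?] := Foo k; have [? ?] := Goo k.
  split; first exact: measurableX.
  by rewrite product_measure1E// lte_mul_pinfty// ge0_fin_numE.
exists (fun i => @uncons_row n @^-1` F i).
  by rewrite -preimage_bigcup -FT.
move=> i; have [mF Fi] := Ffin i; split.
  by rewrite -[X in measurable X]setTI; exact: measurable_uncons_row.
rewrite /lebesgue_row_step /pushforward -comp_preimage.
rewrite (_ : _ \o _ = id)//.
by apply/funext => p /=; rewrite cons_rowK.
Qed.

HB.instance Definition _ :=
  Measure_isSigmaFinite.Build _ _ _ lebesgue_row_step step_sigma_finite.

End step.

(* Lebesgue measure on R^n, as the n-fold product of the one-dimensional
   Lebesgue measure (a Dirac mass at the only point when n = 0). *)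
Fixpoint lebesgue_row n : {sigma_finite_measure set 'rV[R]_n -> \bar R} :=
  match n with
  | 0 => \d_(0 : 'rV[R]_0)
  | n'.+1 => lebesgue_row_step (lebesgue_row n')
  end.

End lebesgue_measure_row.

Section domains.
Context {R : realType} {d : nat}.
Implicit Types (Omega : set 'rV[R]_d) (x y e : 'rV[R]_d).

Definition dotp x y : R := \sum_(i < d) x ord0 i * y ord0 i.

(* The norm `|x| provided by the library on 'rV[R]_d is the sup norm. *)
Definition enorm x : R := Num.sqrt (dotp x x).

(* Near each boundary point Omega is the strict epigraph, in some direction e,
   of a Lipschitz function on the hyperplane orthogonal to e. *)
Definition lipschitz_boundary Omega : Prop :=
  forall x0, (closure Omega `\` interior Omega) x0 ->
  exists (r : R) (e : 'rV[R]_d) (phi : 'rV[R]_d -> R^o),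
    [/\ 0 < r, enorm e = 1,
        [lipschitz phi y | y in [set y | dotp y e = 0]] &
        forall x, enorm (x - x0) < r ->
          (Omega x <-> phi (x - dotp x e *: e) < dotp x e)].

End domains.

Section functionals.
Context {R : realType} {d : nat}.
Variable Omega : set 'rV[R]_d.
Implicit Types (u : 'rV[R]_d -> R) (alpha : R).
Local Open Scope ereal_scope.

Local Notation mu := (@lebesgue_row R d).

Definition omega_d : \bar R := mu [set x : 'rV[R]_d | (enorm x < 1)%R].

(* An element of L^2(Omega) is represented by a function on R^d whose values
   outside Omega are irrelevant; u \_ Omega is its extension by zero. *)
Definition L2 : set ('rV[R]_d -> R) :=
  [set u | (u \_ Omega)%R \in Lfun mu 2%:E].

Definition L2norm u : \bar R := 'N[mu]_2%:E[EFin \o (u \_ Omega)%R].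

Definition L2cvg (un : nat -> 'rV[R]_d -> R) u : Prop :=
  L2norm (un n \- u)%R @[n --> \oo] --> 0.

Definition Jalpha alpha u : \bar R :=
  - \int[mu]_(x in Omega) \int[mu]_(y in Omega)
      (u x * u y / enorm (x - y) `^ (d%:R - alpha))%:E.

Definition Jhat_alpha alpha u : \bar R :=
  Jalpha alpha u + (d%:R / alpha)%:E * omega_d * L2norm u ^+ 2.

Definition D1 : set ('rV[R]_d * 'rV[R]_d) :=
  [set p | (enorm (p.1 - p.2) <= 1)%R].

Definition G01 u : \bar R :=
  2^-1%:E * \int[mu \x mu]_(p in D1)
    (`|(u \_ Omega) p.1 - (u \_ Omega) p.2| ^+ 2
      / enorm (p.1 - p.2) ^+ d)%:E.

Definition J01 u : \bar R :=
  - \int[mu \x mu]_(p in (Omega `*` Omega) `\` D1)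
      (u p.1 * u p.2 / enorm (p.1 - p.2) ^+ d)%:E.

Definition Jhat0 u : \bar R := G01 u + J01 u.

Definition H00 : set ('rV[R]_d -> R) := [set u | L2 u /\ G01 u < +oo].

End functionals.

Arguments omega_d R d : clear implicits.

(* Main.v *)
Require Import Defs.
From mathcomp Require Import all_boot all_order all_algebra.
From mathcomp Require Import all_classical all_reals all_analysis.
From mathcomp Require Import measurable_realfun ring lra.
Import Order.TTheory GRing.Theory Num.Theory.
Import numFieldNormedType.Exports.
Local Open Scope classical_set_scope.
Local Open Scope ring_scope.

Set Implicit Arguments.
Unset Strict Implicit.
Unset Printing Implicit Defensive.

(** Write w for the extension of u by zero. On the unit ball the Riesz kernel
    |z|^(a - d) has mass d omega_d / a, so expanding the square in
    1/2 |w(x) - w(y)|^2 |x - y|^(a - d) over |x - y| <= 1 produces exactly the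
    renormalising term of Jhat_alpha. Hence [Jhat_alphaE]
      Jhat_alpha(u) = 1/2 energy (near_kernel a) w - bform (far_kernel a) w,
    where near_kernel and far_kernel restrict the Riesz kernel to the pairs at
    distance at most 1 and to the pairs of points of Omega at distance more
    than 1. For a = 0 the same expression is Jhat0 [G01E, J01E]. The far kernel
    is bounded by 1 whatever a is, so the far term is jointly continuous in the
    exponent and in u [far_bform_diagonal_cvg]. The near kernel is nonnegative
    and increases as a decreases to 0.

    Limsup: a constant sequence is a recovery sequence, by dominated
    convergence [near_energy_cvg, far_bform_cvg].

    Liminf: the near energy with the fixed exponent alpha k is at most
    C_k times the squared L2 norm, so it is lower semicontinuous for strong L2
    convergence [energy_split, energy_le_sqint]; it lies below the near energy
    with exponent alpha n as soon as alpha n <= alpha k [near_energy_anti]; and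
    it tends to the near energy of exponent 0 when k grows.

    Compactness: the hypothesis bounds the L2 norms and the near energies. Let
    K_N be the sum, over N consecutive dyadic scales h, of h^(-d) times the
    indicator that x and y lie in one cube of side h. Summing a geometric
    series, off the diagonal K_N is at most a constant independent of N times
    |x - y|^(-d), and for small a at most such a constant times near_kernel a
    [scale_kernel_le_riesz]. On the other hand [sqint_cell_kernel] N times the
    squared norm of w is half the K_N-energy of w plus a finite weighted sum of
    squares of integrals of w over cubes. Along a subsequence all the integrals
    over dyadic cubes converge [diagonal_extraction]; applied to differences of
    its terms, the last identity bounds their squared distance by C / N plus a
    vanishing term, so the subsequence is Cauchy and has a limit
    [sqint_complete]. Fatou's lemma bounds the near energy of exponent 0 of the
    limit [near_energy_fatou]. *)

(** * Measurability and the Euclidean norm on row vectors *)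

Section row_measurability.
Context {R : realType}.

Lemma measurable_cylinder n (A : 'I_n -> set (measurableTypeR R)) :
  (forall i, measurable (A i)) ->
  measurable [set x : 'rV[R]_n | forall i, A i (x ord0 i)].
Proof.
move=> mA.
rewrite (_ : [set x | _] = \bigcap_(i in [set: 'I_n])
   ((fun x : 'rV[R]_n => x ord0 i) @^-1` A i)).
  apply: fin_bigcap_measurable => // i _.
  by rewrite -[X in measurable X]setTI; exact: (measurable_coord i measurableT (mA i)).
by apply/seteqP; split => [x Ax i _|x Ax i]; [exact: Ax|exact: (Ax i)].
Qed.

(** The sigma-algebra on row vectors is generated by the coordinates; it
    contains the open sets because each of them is the union of the countably
    many rational boxes that it contains. *)
Lemma open_measurable_row n (O : set 'rV[R]_n) : open O -> measurable O.
Proof.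
move=> oO.
pose box (c : 'rV[rat]_n * nat) : set 'rV[R]_n :=
  [set x | forall i, `](ratr (c.1 ord0 i) - c.2.+1%:R^-1)%R,
     (ratr (c.1 ord0 i) + c.2.+1%:R^-1)[%classic (x ord0 i)].
have mbox c : measurable (box c).
  apply: (@measurable_cylinder n (fun i =>
    `](ratr (c.1 ord0 i) - c.2.+1%:R^-1)%R,
      (ratr (c.1 ord0 i) + c.2.+1%:R^-1)[%classic)) => i.
  exact: measurable_itv.
rewrite (_ : O = \bigcup_c (if `[< box c `<=` O >] then box c else set0)).
  apply: countable_bigcupT_measurable => [|c].
    exact: (@countableP (prod (matrix rat 1 n) nat) setT).
  by case: ifPn.
apply/seteqP; split => [x Ox|x [c _]]; last first.
  by case: asboolP => // cO; exact: cO.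
have /nbhs_ballP[e /= e0 eO] : nbhs x O by apply: open_nbhs_nbhs; split.
have [k ke] : exists k : nat, 2 * k.+1%:R^-1 < e.
  exists (Num.trunc (2 / e)).
  rewrite ltr_pdivrMr// mulrC -ltr_pdivrMr//.
  exact: Num.Theory.truncnS_gt.
have kgt0 : 0 < k.+1%:R^-1 :> R by [].
have qex i : exists q : rat, `|x ord0 i - ratr q| < k.+1%:R^-1.
  have [|q] := @rat_in_itvoo R (x ord0 i - k.+1%:R^-1) (x ord0 i + k.+1%:R^-1).
    by rewrite ltrD2l gtrN.
  by rewrite in_itv/= => qx; exists q; rewrite distrC ltr_distl.
pose q : 'rV[rat]_n := \row_i projT1 (cid (qex i)).
have qP i : `|x ord0 i - ratr (q ord0 i)| < k.+1%:R^-1.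
  by rewrite mxE; case: (cid _).
suff qkO : box (q, k) `<=` O.
  exists (q, k) => //; rewrite asboolT// => i /=.
  by rewrite in_itv/= -ltr_distl.
move=> y /= yb; apply: eO; split => // i j.
rewrite (ord1 i) /ball/=; move: (yb j) => /=; rewrite in_itv/= -ltr_distl => yq.
have -> : x ord0 j - y ord0 j =
  (x ord0 j - ratr (q ord0 j)) + (ratr (q ord0 j) - y ord0 j) by ring.
apply: le_lt_trans (ler_normD _ _) (lt_trans _ ke).
by rewrite [ltRHS]mulr_natl mulr2n ltrD// distrC.
Qed.

Lemma measurable_enorm_sub n : measurable_fun [set: 'rV[R]_n * 'rV[R]_n]
  (fun p => enorm (p.1 - p.2) : measurableTypeR R).
Proof.
rewrite /enorm /dotp.
apply: (@measurableT_comp _ _ _ _ _ _ (@Num.sqrt R)).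
  apply: continuous_measurable_fun; exact: sqrt_continuous.
apply: measurable_sum => i.
have mc : measurable_fun [set: 'rV[R]_n * 'rV[R]_n]
   (fun p => (p.1 - p.2) ord0 i : measurableTypeR R).
  rewrite (_ : (fun _ => _) = (fun p : 'rV[R]_n * 'rV[R]_n => p.1 ord0 i - p.2 ord0 i)); last first.
    by apply/funext => p; rewrite !mxE.
  apply: measurable_funB.
    apply: (@measurableT_comp _ _ _ _ _ _ (fun x : 'rV[R]_n => x ord0 i)) => //.
    exact: measurable_coord.
  apply: (@measurableT_comp _ _ _ _ _ _ (fun x : 'rV[R]_n => x ord0 i)) => //.
  exact: measurable_coord.
exact: measurable_funM.
Qed.

Lemma enorm_ge0 n (x : 'rV[R]_n) : 0 <= enorm x.
Proof. exact: sqrtr_ge0. Qed.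

Lemma enormB n (x y : 'rV[R]_n) : enorm (x - y) = enorm (y - x).
Proof.
rewrite /enorm /dotp; congr Num.sqrt; apply: eq_bigr => i _.
by rewrite !mxE; ring.
Qed.

Lemma enormZ n (r : R) (x : 'rV[R]_n) : 0 <= r -> enorm (r *: x) = r * enorm x.
Proof.
move=> r0; rewrite /enorm.
have -> : dotp (r *: x) (r *: x) = r ^+ 2 * dotp x x.
  by rewrite /dotp mulr_sumr; apply: eq_bigr => i _; rewrite !mxE; ring.
by rewrite sqrtrM ?sqr_ge0// sqrtr_sqr ger0_norm.
Qed.

Lemma coord_le_enorm n (x : 'rV[R]_n) i : `|x ord0 i| <= enorm x.
Proof.
rewrite /enorm -sqrtr_sqr ler_wsqrtr// /dotp (bigD1 i)//= -expr2 lerDl.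
by apply: sumr_ge0 => j _; rewrite -expr2 sqr_ge0.
Qed.

Lemma enorm_eq0 n (x : 'rV[R]_n) : enorm x = 0 -> x = 0.
Proof.
move=> x0; apply/rowP => i; rewrite mxE; apply/normr0_eq0/le_anti.
by rewrite normr_ge0 andbT -x0 coord_le_enorm.
Qed.

Lemma enorm_sub_gt0 n (x y : 'rV[R]_n) : x != y -> 0 < enorm (x - y).
Proof.
move=> xy; rewrite lt_neqAle enorm_ge0 andbT eq_sym; apply/eqP => /enorm_eq0/eqP.
by rewrite subr_eq0; exact/negP.
Qed.

Lemma enorm_le_coord n (x : 'rV[R]_n) h : 0 <= h ->
  (forall i, `|x ord0 i| <= h) -> enorm x <= Num.sqrt n%:R * h.
Proof.
move=> h0 xh; rewrite -[leRHS]ger0_norm ?mulr_ge0 ?sqrtr_ge0//.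
rewrite -sqrtr_sqr /enorm ler_wsqrtr// exprMn sqr_sqrtr// /dotp.
rewrite (@le_trans _ _ (\sum_(i < n) h ^+ 2))//.
  apply: ler_sum => i _; rewrite -expr2 -real_normK ?num_real//.
  by rewrite ler_sqr ?nnegrE.
by rewrite sumr_const card_ord mulr_natl.
Qed.

End row_measurability.

(** * Lebesgue measure of affine preimages and of boxes *)
Section lebesgue_row_affine.
Context {R : realType}.
Local Open Scope ereal_scope.

(** The push-forward of Lebesgue measure under x |-> a + r x is r^-1 times
    Lebesgue measure: by uniqueness it suffices to compare the two on half-open
    intervals. *)
Lemma integral_affine_line (a r : R) (g : R -> \bar R) : (0 < r)%R ->
  measurable_fun setT g -> (forall x, 0 <= g x) ->
  \int[@lebesgue_measure R]_x g (a + r * x)%R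
  = r^-1%:E * \int[@lebesgue_measure R]_x g x.
Proof.
move=> r0 mg g0.
pose phi : measurableTypeR R -> measurableTypeR R := fun x => (a + r * x)%R.
have mphi : measurable_fun setT phi.
  by apply: measurable_funD => //; exact: measurable_funM.
have ri0 : (0 <= r^-1)%R by rewrite invr_ge0 ltW.
have [nu nuE] : exists nu : {measure set (measurableTypeR R) -> \bar R},
    nu = pushforward (@lebesgue_measure R) phi :> (set _ -> \bar R).
  by unshelve eexists (pushforward (@lebesgue_measure R) phi).
transitivity (\int[pushforward (@lebesgue_measure R) phi]_y g y).
  by rewrite ge0_integral_pushforward// ?preimage_setT.
pose k := NngNum ri0; pose k' := NngNum (ltW r0).
transitivity (\int[mscale k (@lebesgue_measure R)]_y g y).
  apply: eq_measure_integral => A mA _.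
  have E : @lebesgue_measure R A = mscale k' nu A.
    apply: lebesgue_measure_unique => // X [[u v] _ <-].
    suff : lebesgue_measure `]u, v]%classic = r%:E * nu `]u, v]%classic by [].
    rewrite nuE /pushforward.
    have -> : phi @^-1` `]u, v] = `]((u - a) / r)%R, ((v - a) / r)%R]%classic.
      apply/seteqP; split => x /=; rewrite !in_itv/= /phi => /andP[h1 h2].
        by rewrite ltr_pdivrMr// ler_pdivlMr//; apply/andP; split; lra.
      move: h1 h2; rewrite ltr_pdivrMr// ler_pdivlMr// => h1 h2.
      by apply/andP; split; lra.
    rewrite !lebesgue_measure_itv/= !lte_fin ltr_pM2r ?invr_gt0// ltrD2r.
    case: ifPn => _; last by rewrite mule0.
    by rewrite -!EFinB -EFinM; congr EFin; field; rewrite gt_eqF.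
  transitivity (nu A); first by rewrite nuE.
  suff -> : nu A = r^-1%:E * @lebesgue_measure R A by [].
  have -> : @lebesgue_measure R A = r%:E * nu A by [].
  by rewrite muleA -EFinM mulVf ?gt_eqF// mul1e.
by rewrite ge0_integral_mscale.
Qed.

Lemma measurable_affine_row n (a : 'rV[R]_n) (r : R) :
  measurable_fun [set: 'rV[R]_n] (fun y : 'rV[R]_n => (a + r *: y)%R).
Proof.
apply: measurable_fun_row => i.
rewrite (_ : (fun _ => _) = (fun y : 'rV[R]_n => a ord0 i + r * y ord0 i)%R); last first.
  by apply/funext => y; rewrite !mxE.
apply: measurable_funD => //; apply: measurable_funM => //.
exact: measurable_coord.
Qed.

(** Induction on the dimension: Fubini's theorem peels off the first
    coordinate, which contributes one factor r^-1. *)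
Lemma lebesgue_row_affine n (a : 'rV[R]_n) (r : R) (A : set 'rV[R]_n) :
  (0 < r)%R -> measurable A ->
  @lebesgue_row R n ((fun y : 'rV[R]_n => (a + r *: y)%R) @^-1` A) =
  (r ^- n)%:E * @lebesgue_row R n A.
Proof.
move=> r0; elim: n a A => [|n IH] a A mA.
  rewrite expr0 invr1 mul1e /= /dirac !indicE.
  congr (_%:E); congr (nat_of_bool _)%:R.
  by apply/idP/idP; rewrite !inE/= (thinmx0 (a + r *: 0)%R).
have mB : measurable (cons_row (n:=n) @^-1` A).
  by rewrite -[X in measurable X]setTI; exact: measurable_cons_row.
have mA' : measurable ((fun y : 'rV[R]_n.+1 => (a + r *: y)%R) @^-1` A).
  by rewrite -[X in measurable X]setTI; exact: measurable_affine_row.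
rewrite /= /lebesgue_row_step /pushforward /= /product_measure1.
set B := cons_row (n:=n) @^-1` A.
pose a' : 'rV[R]_n := rsubmx (a : 'rV_(1 + n)).
pose g s := lebesgue_row n (xsection B s).
transitivity (\int[@lebesgue_measure R]_s ((r ^- n)%:E * g (a ord0 ord0 + r * s)%R)).
  apply: eq_integral => s _ /=.
  rewrite -(IH a'); last exact: measurable_xsection.
  have consE y : cons_row (a ord0 ord0 + r * s, a' + r *: y)%R =
      (a + r *: cons_row (s, y))%R.
    rewrite /cons_row; apply/rowP => i; rewrite !mxE.
    case: (split_ordP (i : 'I_(1 + n))) => j -> /=.
      by rewrite !mxE (ord1 j); congr (a ord0 _ + _)%R; exact/val_inj.
    by rewrite !mxE.
  congr (lebesgue_row n _); apply/seteqP.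
  by split => y; rewrite /xsection /= !inE /= /B /= consE.
have mg : measurable_fun setT g by exact: measurable_fun_xsection.
rewrite ge0_integralZl//; last 2 first.
- by apply: (measurableT_comp mg); apply: measurable_funD => //; exact: measurable_funM.
- by rewrite lee_fin invr_ge0 exprn_ge0// ltW.
rewrite (integral_affine_line _ r0 mg)// muleA -EFinM.
by congr (_%:E * _); rewrite exprS invfM mulrC.
Qed.

Lemma lebesgue_row_box n (A : 'I_n -> set (measurableTypeR R)) :
  (forall i, measurable (A i)) ->
  @lebesgue_row R n [set x | forall i, A i (x ord0 i)] =
  \prod_(i < n) @lebesgue_measure R (A i).
Proof.
elim: n A => [|n IH] A mA.
  rewrite big_ord0 /= /dirac indicE mem_set// => -[].
  by [].
rewrite big_ord_recl /= /lebesgue_row_step /pushforward.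
rewrite -(IH (fun i => A (lift ord0 i)))// -product_measure1E//; last first.
  by apply: (@measurable_cylinder _ _ (fun i => A (lift ord0 i))).
congr (product_measure1 _ _ _); apply/seteqP; split => [[s y]|[s y]] /=.
  move=> h; split.
    move: (h ord0); rewrite /cons_row /=.
    have -> : (ord0 : 'I_n.+1) = lshift n (ord0 : 'I_1) by exact/val_inj.
    by rewrite (@row_mxEl _ 1 1 n) mxE.
  move=> i; move: (h (lift ord0 i)); rewrite /cons_row /=.
  have -> : lift ord0 i = rshift 1 i by exact/val_inj.
  by rewrite (@row_mxEr _ 1 1 n).
move=> [As Ay] i; rewrite /cons_row.
case: (split_ordP (i : 'I_(1 + n))) => j ->.
  rewrite (@row_mxEl _ 1 1 n) mxE.
  by have -> : lshift n j = ord0 by rewrite (ord1 j); exact/val_inj.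
rewrite (@row_mxEr _ 1 1 n).
have -> : rshift 1 j = lift ord0 j by exact/val_inj.
exact: Ay.
Qed.

End lebesgue_row_affine.

(** * Two integrals of powers *)
Section power_integrals.
Context {R : realType}.

Lemma continuous_powR_pos (a t : R) : 0 < t -> {for t, continuous (@powR R ^~ a)}.
Proof.
move=> t0; apply/differentiable_continuous/derivable1_diffP.
by apply: derivable_powR; rewrite in_itv/= t0.
Qed.

Lemma powRN_cvg_y (a : R) : 0 < a -> t `^ (- a) @[t --> +oo%R] --> (0:R).
Proof.
move=> a0; apply/cvgr0Pnorm_lt => e e0; near=> t.
have t0 : 0 < t by near: t; exact: nbhs_pinfty_gt.
rewrite powRN ger0_norm ?invr_ge0 ?powR_ge0// invf_plt ?posrE ?powR_gt0//.
have -> : e^-1 = (e^-1 `^ (a^-1)) `^ a.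
  by rewrite -powRrM mulVf ?gt_eqF// powRr1// invr_ge0 ltW.
rewrite gt0_ltr_powR ?nnegrE ?powR_ge0 ?(ltW t0)//.
Unshelve. all: end_near. Qed.

Lemma integral_powR_1y (a : R) : 0 < a ->
  (\int[@lebesgue_measure R]_(t in `[1%R, +oo[) (t `^ (- a - 1))%:E = (a^-1)%:E)%E.
Proof.
move=> a0; pose F := fun t : R => - a^-1 * t `^ (- a).
rewrite (@ge0_continuous_FTC2y _ _ F _ 0).
- by rewrite /F powR1 mulr1 -EFinB sub0r opprK.
- by move=> t _; exact: powR_ge0.
- apply: continuous_in_subspaceT => t; rewrite inE/= in_itv/= andbT => t1.
  by apply: continuous_powR_pos; lra.
- rewrite -(mulr0 (- a^-1)); apply: cvgM; first exact: cvg_cst.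
  exact: powRN_cvg_y.
- move=> t t1; apply: derivableM => //; apply: derivable_powR.
  by rewrite in_itv/=; lra.
- apply: cvg_at_right_filter; apply: cvgM; first exact: cvg_cst.
  by apply: continuous_powR_pos.
- move=> t; rewrite in_itv/= andbT => t1; have t0 : 0 < t by lra.
  have H := is_derive1_powR (- a) t0.
  rewrite derive1E (_ : F = - a^-1 \*: (@powR R ^~ (- a)))// derive_val.
  by rewrite /GRing.scale/= mulrA mulrNN mulVf ?gt_eqF// mul1r.
Qed.

Lemma integral_powR_1c (b c : R) : 0 < b -> 1 <= c ->
  (\int[@lebesgue_measure R]_(t in `[1%R, c]) (b * t `^ (b - 1))%:E
   = (c `^ b - 1)%:E)%E.
Proof.
move=> b0; rewrite le_eqVlt => /predU1P[<-|c1].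
  by rewrite set_itv1 integral_set1 powR1 subrr.
rewrite (@continuous_FTC2 _ _ (@powR R ^~ b) 1 c c1).
- by rewrite powR1.
- apply: continuous_in_subspaceT => t; rewrite inE/= in_itv/= => /andP[t1 _].
  apply: cvgM; first exact: cvg_cst.
  by apply: continuous_powR_pos; lra.
- split.
  + move=> t; rewrite in_itv/= => /andP[t1 _]; apply: derivable_powR.
    by rewrite in_itv/=; lra.
  + by apply: cvg_at_right_filter; exact: continuous_powR_pos.
  + by apply: cvg_at_left_filter; apply: continuous_powR_pos; lra.
- move=> t; rewrite in_itv/= => /andP[t1 _]; have t0 : 0 < t by lra.
  have H := is_derive1_powR b t0.
  by rewrite derive1E derive_val.
Qed.

End power_integrals.

(** * Volume of balls *)
Section balls.
Context {R : realType} (n : nat).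
Local Notation mu := (@lebesgue_row R n).
Local Open Scope ereal_scope.

Lemma bounded_coord (O : set 'rV[R]_n) : bounded_set O ->
  exists B : R, (0 < B)%R /\ forall x, O x -> forall i, (`|x ord0 i| < B)%R.
Proof.
move=> [M [Mr OM]]; exists (`|M| + 2)%R; split.
  by rewrite ltr_wpDl.
move=> x Ox i; have M1 : (M < `|M| + 1)%R.
  by rewrite (le_lt_trans (ler_norm _))// ltrDl.
have h := OM _ M1 x Ox.
apply: (@le_lt_trans _ _ (`|M| + 1)%R); last by rewrite ltrD2l; lra.
apply: le_trans h; rewrite /Num.norm/= mx_normrE.
exact: (le_bigmax _ _ (ord0, i)).
Qed.

Lemma lebesgue_row_bounded (O : set 'rV[R]_n) : bounded_set O ->
  measurable O -> mu O < +oo.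
Proof.
move=> /bounded_coord[B [B0 OB]] mO.
pose box := [set x : 'rV[R]_n | forall i, `](- B)%R, B[%classic (x ord0 i)].
have mbox : measurable box.
  by apply: (@measurable_cylinder _ _ (fun=> `](- B)%R, B[%classic)) => i.
apply: (@le_lt_trans _ _ (mu box)).
  apply: le_measure; rewrite ?inE// => x Ox i /=.
  by rewrite in_itv/= -ltr_norml; exact: OB.
rewrite (lebesgue_row_box (fun=> measurable_itv _)).
suff : 0 <= \prod_(i < n) @lebesgue_measure R `](- B)%R, B[%classic < +oo.
  by case/andP.
elim/big_ind : _ => [|x y /andP[x0 xy] /andP[y0 yy]|i _].
- by rewrite lee01 ltry.
- by rewrite mule_ge0// lte_mul_pinfty// ge0_fin_numE.
- by rewrite lebesgue_measure_itv/= lte_fin; case: ifPn => _;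
    rewrite -?EFinB ?ltry ?lee_fin ?lexx// andbT; lra.
Qed.

Local Notation omega := (omega_d R n).

Lemma measurable_enorm_subr (x : 'rV[R]_n) :
  measurable_fun [set: 'rV[R]_n] (fun y => enorm (x - y) : measurableTypeR R).
Proof.
exact: (measurableT_comp (@measurable_enorm_sub R n) (pair1_measurable x)).
Qed.

Lemma measurable_enorm_lt (x : 'rV[R]_n) s :
  measurable [set y : 'rV[R]_n | (enorm (x - y) < s)%R].
Proof.
have mI : measurable (`]-oo, s[%classic : set R) by exact: measurable_itv.
have := measurable_enorm_subr x measurableT mI.
by rewrite setTI; congr (measurable _).
Qed.

Lemma measurable_enorm_le (x : 'rV[R]_n) s :
  measurable [set y : 'rV[R]_n | (enorm (x - y) <= s)%R].
Proof.
have mI : measurable (`]-oo, s]%classic : set R) by exact: measurable_itv.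
have := measurable_enorm_subr x measurableT mI.
by rewrite setTI; congr (measurable _).
Qed.

Lemma enormN (x : 'rV[R]_n) : enorm (- x)%R = enorm x.
Proof. by rewrite -[LHS](congr1 _ (sub0r x)) enormB subr0. Qed.

Lemma lebesgue_row_ball (x : 'rV[R]_n) (s : R) : (0 < s)%R ->
  mu [set y | (enorm (x - y) < s)%R] = (s ^+ n)%:E * omega.
Proof.
move=> s0; have mB := measurable_enorm_lt x s.
rewrite /omega_d.
have -> : [set y : 'rV[R]_n | (enorm y < 1)%R] =
    (fun y : 'rV[R]_n => (x + s *: y)%R) @^-1` [set y | (enorm (x - y) < s)%R].
  apply/seteqP; split => y /=.
    by rewrite opprD addrA subrr sub0r enormN enormZ ?ltW// gtr_pMr.
  by rewrite opprD addrA subrr sub0r enormN enormZ ?ltW// gtr_pMr.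
rewrite lebesgue_row_affine// muleA -EFinM divff ?mul1e//.
by rewrite expf_neq0// gt_eqF.
Qed.

Lemma omega_d_fin : omega \is a fin_num.
Proof.
rewrite ge0_fin_numE ?measure_ge0//; apply: lebesgue_row_bounded.
  exists 1%R; split => // M M1 x /= x1; apply: le_trans (ltW M1).
  rewrite /Num.norm/= mx_normrE; apply: bigmax_le => // -[i j] _ /=.
  by rewrite (ord1 i) (le_trans (coord_le_enorm _ _))// ltW.
rewrite (_ : [set _ | _] = [set y | (enorm (0 - y) < 1)%R]).
  exact: measurable_enorm_lt.
by apply/seteqP; split => y /=; rewrite sub0r enormN.
Qed.

(** Closed balls have the volume of open balls: a closed ball lies in every
    open ball with the same centre and a larger radius, whose volume is a
    continuous function of the radius. *)
Lemma lebesgue_row_closed_ball (x : 'rV[R]_n) (s : R) : (0 < s)%R ->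
  mu [set y | (enorm (x - y) <= s)%R] = (s ^+ n)%:E * omega.
Proof.
move=> s0; have mc := measurable_enorm_le x s.
have le1 r : (s < r)%R ->
    mu [set y | (enorm (x - y) <= s)%R] <= (r ^+ n)%:E * omega.
  move=> r1; rewrite -(lebesgue_row_ball x); last lra.
  apply: le_measure; rewrite ?inE//; first exact: measurable_enorm_lt.
  by move=> y /= /le_lt_trans; exact.
have fm : mu [set y | (enorm (x - y) <= s)%R] \is a fin_num.
  rewrite ge0_fin_numE ?measure_ge0//.
  apply: le_lt_trans (le1 (s + 1)%R _) _; first lra.
  by rewrite -(fineK omega_d_fin) -EFinM ltry.
apply/eqP; rewrite eq_le; apply/andP; split; last first.
  rewrite -(lebesgue_row_ball x)//.
  apply: le_measure; rewrite ?inE//; first exact: measurable_enorm_lt.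
  by move=> y /=; exact: ltW.
rewrite -(fineK fm) -(fineK omega_d_fin) -EFinM lee_fin.
apply: (@cvgr_to_ge R (at_right s) _ R (fun r => r ^+ n * fine omega)%R).
  apply: cvg_at_right_filter; apply: cvgM; last exact: cvg_cst.
  exact: exprn_continuous.
near=> r.
rewrite -lee_fin EFinM !fineK ?omega_d_fin//.
by apply: le1; near: r; exact: nbhs_right_gt.
Unshelve. all: by end_near. Qed.

Lemma lebesgue_row_set1 (x : 'rV[R]_n) : (0 < n)%N -> mu [set x] = 0.
Proof.
move=> n0; rewrite (_ : [set x] =
    [set y | forall i, [set x ord0 i] (y ord0 i)]); last first.
  by apply/seteqP; split => [y -> i //|y /= xy]; apply/rowP.
rewrite (@lebesgue_row_box _ _ (fun i => [set x ord0 i]))//.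
by rewrite (bigD1 (Ordinal n0))//= lebesgue_measure_set1 mul0e.
Qed.

End balls.

(** * The Riesz kernel and its mass on the unit ball *)
Lemma measurable_fun_powR (R : realType) d (T : measurableType d) (D : set T)
    (f : T -> R) (p : R) :
  measurable_fun D f -> measurable_fun D (fun x => f x `^ p).
Proof.
by move=> mf; apply: (@measurableT_comp _ _ _ _ _ _ (@powR R ^~ p)).
Qed.

Section riesz_kernel.
Context {R : realType} (n : nat).
Local Notation mu := (@lebesgue_row R n).
Local Notation omega := (omega_d R n).
Local Open Scope ereal_scope.

(** The kernel vanishes on the diagonal when [a < n], as the power function
    takes the value 0 at 0 for every nonzero exponent. *)
Definition riesz (a : R) (p : 'rV[R]_n * 'rV[R]_n) : R :=
  enorm (p.1 - p.2) `^ (a - n%:R).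

Lemma measurable_riesz a : measurable_fun [set: 'rV[R]_n * 'rV[R]_n] (riesz a).
Proof.
by apply: measurable_fun_powR; exact: measurable_enorm_sub.
Qed.

Lemma measurable_D1 : measurable (@D1 R n).
Proof.
have mI : measurable (`]-oo, 1%R]%classic : set R) by exact: measurable_itv.
have := @measurable_enorm_sub R n measurableT _ mI.
by rewrite setTI; congr (measurable _).
Qed.

Definition near_kernel (a : R) (p : 'rV[R]_n * 'rV[R]_n) : R :=
  (\1_(@D1 R n) p * riesz a p)%R.

Lemma near_kernel_ge0 a p : (0 <= near_kernel a p)%R.
Proof. by rewrite mulr_ge0// powR_ge0. Qed.

Lemma measurable_near_kernel a : measurable_fun setT (near_kernel a).
Proof.
apply: measurable_funM; last exact: measurable_riesz.
exact: measurable_indic measurable_D1.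
Qed.

Lemma riesz_sym a (x y : 'rV[R]_n) : riesz a (x, y) = riesz a (y, x).
Proof. by rewrite /riesz /= enormB. Qed.

Lemma D1_sym (x y : 'rV[R]_n) : @D1 R n (x, y) <-> @D1 R n (y, x).
Proof. by rewrite /D1 /= enormB. Qed.

Lemma near_kernel_sym a x y : near_kernel a (x, y) = near_kernel a (y, x).
Proof.
rewrite /near_kernel riesz_sym !indicE; congr ((_ : bool)%:R * _)%R.
by apply/idP/idP; rewrite !inE => /D1_sym.
Qed.

(** A negative power written as a superposition of indicators of balls. The
    radius is parametrised by its inverse t, which ranges over [1, +oo[, so that
    the singularity at 0 becomes an integral at infinity. *)
Lemma riesz_layer_cake (b z : R) : (0 < b)%R -> (0 < z)%R ->
  ((z <= 1)%R%:R * z `^ (- b))%:E = ((z <= 1)%R%:R)%:E +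
   \int[@lebesgue_measure R]_(t in `[1%R, +oo[)
      (b * t `^ (b - 1) * (z * t <= 1)%R%:R)%:E.
Proof.
move=> b0 z0; have [z1|z1] := leP z 1%R; last first.
  rewrite mul0r add0e integral0_eq// => t /=; rewrite in_itv/= andbT => t1.
  rewrite leNgt (_ : 1 < z * t)%R ?mulr0//.
  by rewrite (lt_le_trans z1)// ler_peMr// ltW.
rewrite mul1r.
have zi1 : (1 <= z^-1)%R by rewrite invf_ge1.
transitivity (1%:E + \int[@lebesgue_measure R]_(t in `[1%R, z^-1%R])
   (b * t `^ (b - 1))%:E).
  rewrite integral_powR_1c// -EFinD; congr EFin.
  rewrite powRN -[X in (X `^ b - 1)%R]powR_inv1 ?ltW// -powRrM mulN1r powRN.
  by ring.
congr (_ + _); rewrite integral_mkcond [RHS]integral_mkcond.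
apply: eq_integral => t _; rewrite !patchE.
have E : (z * t <= 1)%R = (t <= z^-1)%R.
  by rewrite -[in RHS](mul1r z^-1%R) ler_pdivlMr// mulrC.
rewrite !mem_setE !in_itv/= andbT E.
by case: (1 <= t)%R => //=; case: (t <= z^-1)%R; rewrite ?mulr1 ?mulr0.
Qed.

(** Layer-cake integration: by Tonelli's theorem and the volume of balls,
    the mass is omega + (n - a) omega times the integral over t >= 1 of
    t^(n - a - 1) t^(-n), that is omega (1 + (n - a) / a). *)
Lemma integral_near_kernel (a : R) (x : 'rV[R]_n) : (0 < a < n%:R)%R ->
  \int[mu]_y (near_kernel a (x, y))%:E = (n%:R / a)%:E * omega.
Proof.
rewrite /near_kernel =>  /andP[a0 an]; have n0 : (0 < n)%N by rewrite -(ltr_nat R); lra.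
pose b := (n%:R - a)%R; have b0 : (0 < b)%R by rewrite subr_gt0.
pose I := `[1%R, +oo[%classic : set (measurableTypeR R).
pose f (p : 'rV[R]_n * measurableTypeR R) : \bar R :=
  (\1_I p.2 * (b * p.2 `^ (b - 1)) * (enorm (x - p.1) * p.2 <= 1)%R%:R)%:E.
have f0 p : 0 <= f p.
  by rewrite lee_fin ?(mulr_ge0, powR_ge0, ler0n, indicE) ?ltW.
have mI : measurable I by exact: measurable_itv.
have mf : measurable_fun setT f.
  have mt : measurable_fun [set: 'rV[R]_n * measurableTypeR R] snd by [].
  have mz : measurable_fun [set: 'rV[R]_n * measurableTypeR R]
      (fun p => enorm (x - p.1) : measurableTypeR R).
    by apply: (measurableT_comp (measurable_enorm_subr x)).
  apply/measurable_EFinP; apply: measurable_funM.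
    apply: measurable_funM.
      by apply: (measurableT_comp (measurable_indic mI)).
    apply: measurable_funM => //.
    exact: measurable_fun_powR.
  have mZ : measurable [set p : 'rV[R]_n * measurableTypeR R |
      (enorm (x - p.1) * p.2 <= 1)%R].
    have mI1 : measurable (`]-oo, 1%R]%classic : set R) by exact: measurable_itv.
    have := measurable_funM mz mt measurableT mI1.
    by rewrite setTI; congr (measurable _).
  apply: eq_measurable_fun (measurable_indic mZ) => p _.
  by rewrite indicE mem_setE.
have layer y : y != x -> (\1_(@D1 R n) (x, y) * riesz a (x, y))%:E =
    (\1_[set y | (enorm (x - y) <= 1)%R] y)%:E +
     \int[@lebesgue_measure R]_t f (y, t).
  move=> yx; have z0 : (0 < enorm (x - y))%R by apply: enorm_sub_gt0; rewrite eq_sym.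
  have := riesz_layer_cake b0 z0.
  rewrite /riesz/= opprB !indicE !mem_setE => ->; congr (_ + _).
  rewrite integral_mkcond; apply: eq_integral => t _.
  rewrite patchE /f /= indicE; case: ifPn => tI; rewrite ?mul1r//.
  by rewrite !mul0r.
transitivity (\int[mu]_y ((\1_[set y | (enorm (x - y) <= 1)%R] y)%:E +
     \int[@lebesgue_measure R]_t f (y, t))).
  apply: ae_eq_integral => //.
  - apply/measurable_EFinP/(measurableT_comp (measurable_near_kernel a)).
    exact: pair1_measurable.
  - apply: emeasurable_funD; last exact: measurable_fun_fubini_tonelli_F.
    by apply/measurable_EFinP/measurable_indic; exact: measurable_enorm_le.
  (* the layer-cake formula fails only at y = x *)
  - exists [set x]; split; [|exact: lebesgue_row_set1|].
      rewrite (_ : [set x] = [set y | forall i, [set x ord0 i] (y ord0 i)]).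
        by apply: (@measurable_cylinder _ _ (fun i => [set x ord0 i])).
      by apply/seteqP; split => [y -> i //|y /= xy]; apply/rowP.
    move=> y /= /not_implyP[_ yN]; apply/eqP/negPn/negP => yx.
    by apply: yN; exact: layer.
rewrite ge0_integralD//; last 3 first.
- by apply/measurable_EFinP/measurable_indic; exact: measurable_enorm_le.
- by move=> y _; apply: integral_ge0.
- exact: measurable_fun_fubini_tonelli_F.
rewrite integral_indic ?setIT//; last exact: measurable_enorm_le.
rewrite [X in X + _](lebesgue_row_closed_ball x ltr01) expr1n mul1e.
rewrite fubini_tonelli//.
transitivity (omega + \int[@lebesgue_measure R]_(t in I)
    ((b * fine omega)%:E * (t `^ (- a - 1))%:E)).
  congr (_ + _); rewrite [RHS]integral_mkcond; apply: eq_integral => t _.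
  rewrite patchE; case: ifPn => tI; last first.
    apply: integral0_eq => y _.
    by rewrite /f/= indicE (negbTE tI) !mul0r.
  have t1 : (1 <= t)%R by move: tI; rewrite inE /I/= in_itv/= andbT.
  have t0 : (0 < t)%R by lra.
  transitivity (\int[mu]_y ((b * t `^ (b - 1))%:E *
      (\1_[set y | (enorm (x - y) <= t^-1)%R] y)%:E)).
    apply: eq_integral => y _; rewrite /f/= indicE tI mul1r -EFinM.
    rewrite indicE mem_setE/= -[X in _ = ((_ * (_ <= X)%R%:R)%R)%:E](mul1r t^-1%R).
    by rewrite ler_pdivlMr.
  rewrite ge0_integralZl//; last 2 first.
  + by apply/measurable_EFinP/measurable_indic; exact: measurable_enorm_le.
  + by rewrite lee_fin mulr_ge0 ?powR_ge0// ltW.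
  rewrite integral_indic ?setIT//; last exact: measurable_enorm_le.
  have ti0 : (0 < t^-1)%R by rewrite invr_gt0.
  rewrite [X in _ * X](lebesgue_row_closed_ball x ti0).
  rewrite -(fineK (@omega_d_fin R n)) -!EFinM; congr EFin.
  have -> : (t `^ (b - 1) = t ^+ n * t `^ (- a - 1))%R.
    rewrite -powR_mulrn ?ltW// -powRD; last by rewrite (gt_eqF t0) implybT.
    by congr (t `^ _)%R; rewrite /b; ring.
  rewrite /= exprVn.
  by field; rewrite expf_neq0// gt_eqF.
rewrite ge0_integralZl//; first last.
- by rewrite lee_fin mulr_ge0 ?fine_ge0 ?measure_ge0// ltW.
- by move=> t _; rewrite lee_fin powR_ge0.
- by apply/measurable_EFinP; apply: measurable_funTS; exact: measurable_powR.
rewrite integral_powR_1y// -(fineK (@omega_d_fin R n)) -!EFinM -EFinD /=.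
by congr EFin; rewrite /b; field; rewrite gt_eqF.
Qed.

End riesz_kernel.

(** * Quadratic forms attached to a kernel *)
Section energy.
Context {R : realType} {dT : measure_display} {T : measurableType dT}.
Variable mu : {sigma_finite_measure set T -> \bar R}.
Local Open Scope ereal_scope.
Implicit Types (K : T * T -> R) (u v w : T -> R).

Definition sqint w : \bar R := \int[mu]_x (w x ^+ 2)%:E.

Definition energy K w : \bar R :=
  \int[(mu \x mu)]_p (K p * (w p.1 - w p.2) ^+ 2)%:E.

Definition bform K w : \bar R :=
  \int[(mu \x mu)]_p (K p * (w p.1 * w p.2))%:E.

Lemma sqint_ge0 w : 0 <= sqint w.
Proof. by apply: integral_ge0 => x _; rewrite lee_fin sqr_ge0. Qed.

Lemma measurable_sqr w : measurable_fun setT w ->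
  measurable_fun setT (fun x => (w x ^+ 2)%:E).
Proof. by move=> mw; apply/measurable_EFinP; exact: measurable_funX. Qed.

Lemma measurable_fst_comp w : measurable_fun setT w ->
  measurable_fun [set: T * T] (fun p => w p.1).
Proof. by move=> mw; exact: measurableT_comp. Qed.

Lemma measurable_snd_comp w : measurable_fun setT w ->
  measurable_fun [set: T * T] (fun p => w p.2).
Proof. by move=> mw; exact: measurableT_comp. Qed.

Lemma measurable_energy K w : measurable_fun setT K -> measurable_fun setT w ->
  measurable_fun [set: T * T] (fun p => (K p * (w p.1 - w p.2) ^+ 2)%:E).
Proof.
move=> mK mw; apply/measurable_EFinP/measurable_funM => //.
apply: measurable_funX; apply: measurable_funB.
  exact: measurable_fst_comp.
exact: measurable_snd_comp.
Qed.

Lemma measurable_bform K w : measurable_fun setT K -> measurable_fun setT w ->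
  measurable_fun [set: T * T] (fun p => (K p * (w p.1 * w p.2))%:E).
Proof.
move=> mK mw; apply/measurable_EFinP/measurable_funM => //.
apply: measurable_funM.
  exact: measurable_fst_comp.
exact: measurable_snd_comp.
Qed.

Lemma sqintD_le u v : measurable_fun setT u -> measurable_fun setT v ->
  sqint (u \+ v)%R <= 2%:E * sqint u + 2%:E * sqint v.
Proof.
move=> mu_ mv; rewrite /sqint -!ge0_integralZl//; try exact: measurable_sqr;
  try by move=> *; rewrite lee_fin sqr_ge0.
rewrite -ge0_integralD//; last 4 first.
- by move=> x _; rewrite mule_ge0// lee_fin sqr_ge0.
- by apply: measurable_funeM; exact: measurable_sqr.
- by move=> x _; rewrite mule_ge0// lee_fin sqr_ge0.
- by apply: measurable_funeM; exact: measurable_sqr.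
apply: ge0_le_integral => //.
- by move=> x _; rewrite lee_fin sqr_ge0.
- by apply: measurable_sqr; exact: measurable_funD.
- by apply: emeasurable_funD; apply: measurable_funeM; exact: measurable_sqr.
move=> x _; rewrite -!EFinM -EFinD lee_fin /=.
by have := sqr_ge0 (u x - v x)%R; nra.
Qed.

Lemma sqintN v : sqint (\- v)%R = sqint v.
Proof. by apply: eq_integral => x _; rewrite /= sqrrN. Qed.

Lemma sqintB_le u v : measurable_fun setT u -> measurable_fun setT v ->
  sqint (u \- v)%R <= 2%:E * sqint u + 2%:E * sqint v.
Proof.
move=> mu_ mv; rewrite -(sqintN v); apply: sqintD_le => //.
exact: measurable_funN.
Qed.

Section kernel.
Variable K : T * T -> R.
Hypothesis K0 : forall p, (0 <= K p)%R.
Hypothesis mK : measurable_fun setT K.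
Hypothesis Ksym : forall x y, K (x, y) = K (y, x).

Lemma energy_ge0 w : 0 <= energy K w.
Proof.
by apply: integral_ge0 => p _; rewrite lee_fin mulr_ge0// sqr_ge0.
Qed.

(** Young's inequality (a + b)^2 <= (1 + e) a^2 + (1 + 1/e) b^2 under the
    integral. With [energy_le_sqint] it makes the energy of a kernel of bounded
    mass lower semicontinuous in L2, without any integrability condition. *)
Lemma energy_split (e : R) u v : (0 < e)%R ->
  measurable_fun setT u -> measurable_fun setT v ->
  energy K u <= (1 + e)%:E * energy K v + (1 + e^-1)%:E * energy K (u \- v)%R.
Proof.
move=> e0 mu_ mv.
have ei0 : (0 < e^-1)%R by rewrite invr_gt0.
have f0 w p : 0 <= (K p * (w p.1 - w p.2) ^+ 2)%:E.
  by rewrite lee_fin mulr_ge0// sqr_ge0.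
have e1 : 0 <= (1 + e)%:E by rewrite lee_fin; lra.
have e2 : 0 <= (1 + e^-1)%:E by rewrite lee_fin; lra.
have muv : measurable_fun setT (u \- v)%R by exact: measurable_funB.
rewrite /energy -!ge0_integralZl//; try exact: measurable_energy.
rewrite -ge0_integralD//; last 4 first.
- by move=> x _; rewrite mule_ge0.
- by apply: measurable_funeM; exact: measurable_energy.
- by move=> x _; rewrite mule_ge0.
- by apply: measurable_funeM; exact: measurable_energy.
apply: ge0_le_integral => //.
- exact: measurable_energy.
- by apply: emeasurable_funD; apply: measurable_funeM; exact: measurable_energy.
move=> p _; rewrite -!EFinM -EFinD lee_fin /=.
rewrite [X in (_ <= X + _)%R]mulrCA [X in (_ <= _ + X)%R]mulrCA -mulrDr.
apply: ler_wpM2l => //.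
set a := (v p.1 - v p.2)%R.
have -> : (u p.1 - u p.2 = a + (u p.1 - v p.1 - (u p.2 - v p.2)))%R.
  by rewrite /a; ring.
set b := (u p.1 - _ - _)%R.
have : (0 <= e^-1 * (e * a - b) ^+ 2)%R by rewrite mulr_ge0 ?sqr_ge0// ltW.
have -> : (e^-1 * (e * a - b) ^+ 2 = e * a ^+ 2 - 2 * a * b + e^-1 * b ^+ 2)%R.
  by field; rewrite gt_eqF.
by nra.
Qed.

Lemma energyB_le u v : measurable_fun setT u -> measurable_fun setT v ->
  energy K (u \- v)%R <= 2%:E * energy K u + 2%:E * energy K v.
Proof.
move=> mu_ mv.
have := energy_split (ltr01 : (0 < 1 :> R)%R) (measurable_funB mu_ mv) mu_.
rewrite invr1 (_ : 1 + 1 = 2)%R//; congr (_ <= _ + _ * _).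
apply: eq_integral => p _; congr EFin; congr (_ * _)%R.
by rewrite /=; ring.
Qed.

Definition rowint x : \bar R := \int[mu]_y (K (x, y))%:E.

Lemma rowint_ge0 x : 0 <= rowint x.
Proof. by apply: integral_ge0 => y _; rewrite lee_fin. Qed.

Lemma measurable_rowint : measurable_fun setT rowint.
Proof.
apply: (@measurable_fun_fubini_tonelli_F _ _ _ _ _ _ (EFin \o K)).
  exact/measurable_EFinP.
by move=> p; rewrite /= lee_fin.
Qed.

Lemma integral_weight_fst w : measurable_fun setT w ->
  \int[(mu \x mu)]_p (K p * w p.1 ^+ 2)%:E
  = \int[mu]_x ((w x ^+ 2)%:E * rowint x).
Proof.
move=> mw.
rewrite fubini_tonelli1.
- apply: eq_integral => x _; rewrite /fubini_F /= /rowint.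
  rewrite -ge0_integralZl//.
  + by apply: eq_integral => y _; rewrite mulrC EFinM.
  + by apply/measurable_EFinP; exact: (measurableT_comp mK (pair1_measurable x)).
  + by move=> y _; rewrite lee_fin.
  + by rewrite lee_fin sqr_ge0.
- apply/measurable_EFinP/measurable_funM => //; apply: measurable_funX.
  exact: measurable_fst_comp.
- by move=> p; rewrite lee_fin mulr_ge0// sqr_ge0.
Qed.

Lemma integral_weight_snd w : measurable_fun setT w ->
  \int[(mu \x mu)]_p (K p * w p.2 ^+ 2)%:E
  = \int[mu]_x ((w x ^+ 2)%:E * rowint x).
Proof.
move=> mw.
rewrite fubini_tonelli2.
- apply: eq_integral => x _; rewrite /fubini_G /= /rowint.
  rewrite -ge0_integralZl//.
  + by apply: eq_integral => y _; rewrite mulrC EFinM Ksym.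
  + by apply/measurable_EFinP; exact: (measurableT_comp mK (pair1_measurable x)).
  + by move=> y _; rewrite lee_fin.
  + by rewrite lee_fin sqr_ge0.
- apply/measurable_EFinP/measurable_funM => //; apply: measurable_funX.
  exact: measurable_snd_comp.
- by move=> p; rewrite lee_fin mulr_ge0// sqr_ge0.
Qed.

Variable C : R.
Hypothesis C0 : (0 <= C)%R.
Hypothesis KC : forall x, rowint x <= C%:E.

Lemma rowint_weight_le w : measurable_fun setT w ->
  \int[mu]_x ((w x ^+ 2)%:E * rowint x) <= C%:E * sqint w.
Proof.
move=> mw; rewrite /sqint -ge0_integralZl//; last 2 first.
- exact: measurable_sqr.
- by move=> x _; rewrite lee_fin sqr_ge0.
apply: ge0_le_integral => //.
- by move=> x _; rewrite mule_ge0 ?rowint_ge0// lee_fin sqr_ge0.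
- by apply: emeasurable_funM; [exact: measurable_sqr|exact: measurable_rowint].
- by apply: measurable_funeM; exact: measurable_sqr.
- by move=> x _; rewrite muleC lee_wpmul2r// lee_fin sqr_ge0.
Qed.

Let f0 w p : 0 <= (K p * w p.1 ^+ 2)%:E.
Proof. by rewrite lee_fin mulr_ge0// sqr_ge0. Qed.

Let g0 w p : 0 <= (K p * w p.2 ^+ 2)%:E.
Proof. by rewrite lee_fin mulr_ge0// sqr_ge0. Qed.

Let mf w : measurable_fun setT w ->
  measurable_fun [set: T * T] (fun p => (K p * w p.1 ^+ 2)%:E).
Proof.
move=> mw; apply/measurable_EFinP/measurable_funM => //; apply: measurable_funX.
exact: measurable_fst_comp.
Qed.

Let mg w : measurable_fun setT w ->
  measurable_fun [set: T * T] (fun p => (K p * w p.2 ^+ 2)%:E).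
Proof.
move=> mw; apply/measurable_EFinP/measurable_funM => //; apply: measurable_funX.
exact: measurable_snd_comp.
Qed.

(** From (w(x) - w(y))^2 <= 2 w(x)^2 + 2 w(y)^2: by symmetry of the kernel both
    terms integrate to at most C times the squared norm (Schur's test). *)
Lemma energy_le_sqint w : measurable_fun setT w ->
  energy K w <= (4 * C)%:E * sqint w.
Proof.
move=> mw.
apply: (@le_trans _ _ (2%:E * (C%:E * sqint w) + 2%:E * (C%:E * sqint w))).
  apply: (@le_trans _ _
    (\int[(mu \x mu)]_p (2%:E * (K p * w p.1 ^+ 2)%:E + 2%:E * (K p * w p.2 ^+ 2)%:E))).
    apply: ge0_le_integral => //.
    - by move=> p _; rewrite lee_fin mulr_ge0// sqr_ge0.
    - exact: measurable_energy.
    - by apply: emeasurable_funD; apply: measurable_funeM; [exact: mf|exact: mg].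
    move=> p _; rewrite -!EFinM -EFinD lee_fin /=.
    rewrite [X in (_ <= X + _)%R]mulrCA [X in (_ <= _ + X)%R]mulrCA -mulrDr.
    apply: ler_wpM2l => //.
    by have := sqr_ge0 (w p.1 + w p.2)%R; nra.
  rewrite ge0_integralD//; last 4 first.
  - by move=> p _; rewrite mule_ge0.
  - by apply: measurable_funeM; exact: mf.
  - by move=> p _; rewrite mule_ge0.
  - by apply: measurable_funeM; exact: mg.
  rewrite !ge0_integralZl//; [|exact: mg|exact: mf].
  rewrite integral_weight_fst// integral_weight_snd//.
  by rewrite leeD// lee_wpmul2l// rowint_weight_le.
rewrite -ge0_muleDl// -EFinD muleA -EFinM.
by rewrite (_ : (2 + 2) * C = 4 * C)%R//; ring.
Qed.

Section finite.
Variable w : T -> R.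
Hypothesis mw : measurable_fun setT w.
Hypothesis w2 : sqint w < +oo.

Lemma integrable_weight_fst :
  (mu \x mu).-integrable setT (fun p => (K p * w p.1 ^+ 2)%:E).
Proof.
apply/integrableP; split; first exact: mf.
under eq_integral do rewrite gee0_abs//.
rewrite integral_weight_fst//; apply: le_lt_trans (rowint_weight_le mw) _.
by rewrite lte_mul_pinfty// lee_fin.
Qed.

Lemma integrable_weight_snd :
  (mu \x mu).-integrable setT (fun p => (K p * w p.2 ^+ 2)%:E).
Proof.
apply/integrableP; split; first exact: mg.
under eq_integral do rewrite gee0_abs//.
rewrite integral_weight_snd//; apply: le_lt_trans (rowint_weight_le mw) _.
by rewrite lte_mul_pinfty// lee_fin.
Qed.

Let half_sum p : (K p * w p.1 ^+ 2)%:E + (K p * w p.2 ^+ 2)%:E =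
  (K p * (w p.1 ^+ 2 + w p.2 ^+ 2))%:E.
Proof. by rewrite -EFinD mulrDr. Qed.

Lemma integrable_bform :
  (mu \x mu).-integrable setT (fun p => (K p * (w p.1 * w p.2))%:E).
Proof.
apply: (@le_integrable _ _ _ _ _ _ _
  (fun p => (K p * w p.1 ^+ 2)%:E + (K p * w p.2 ^+ 2)%:E)) => //.
- exact: measurable_bform.
- move=> p _; rewrite half_sum /= lee_fin normrM [leRHS]normrM.
  apply: ler_wpM2l => //; rewrite [leRHS]ger0_norm ?addr_ge0 ?sqr_ge0//.
  rewrite ler_norml.
  have := sqr_ge0 (w p.1 + w p.2)%R; have := sqr_ge0 (w p.1 - w p.2)%R.
  have := sqr_ge0 (w p.1)%R; have := sqr_ge0 (w p.2)%R.
  by nra.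
- by apply: integrableD => //; [exact: integrable_weight_fst|exact: integrable_weight_snd].
Qed.

Lemma bform_fin_num : bform K w \is a fin_num.
Proof. exact: integrable_fin_num integrable_bform. Qed.

(** Expanding the square; the two diagonal terms coincide by symmetry. *)
Lemma energy_bform : 2^-1%:E * energy K w =
  \int[mu]_x ((w x ^+ 2)%:E * rowint x) - bform K w.
Proof.
have E : energy K w = \int[(mu \x mu)]_p
    (((K p * w p.1 ^+ 2)%:E + (K p * w p.2 ^+ 2)%:E)
     - 2%:E * (K p * (w p.1 * w p.2))%:E).
  apply: eq_integral => p _; rewrite -!EFinM -!EFinD; congr EFin; ring.
have i1 := integrable_weight_fst; have i2 := integrable_weight_snd.
have ib := integrable_bform.
rewrite E integralB//; last 2 first.
- exact: integrableD.
- exact: integrableZl.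
rewrite integralD// integralZl// integral_weight_fst// integral_weight_snd//.
have := bform_fin_num; rewrite -/(bform K w).
have : \int[mu]_x ((w x ^+ 2)%:E * rowint x) \is a fin_num.
  by rewrite -integral_weight_fst//; exact: integrable_fin_num i1.
move=> /fineK <- /fineK <-; rewrite -!EFinM -!EFinD; congr EFin.
by field.
Qed.

Lemma abs_bform_le : `|bform K w| <= C%:E * sqint w.
Proof.
apply: le_trans (rowint_weight_le mw).
have i1 := integrable_weight_fst; have i2 := integrable_weight_snd.
have ib := integrable_bform.
apply: le_trans (le_abse_integral _ _ _) _ => //; first exact: measurable_bform.
apply: (@le_trans _ _ (\int[(mu \x mu)]_p
    (2^-1%:E * ((K p * w p.1 ^+ 2)%:E + (K p * w p.2 ^+ 2)%:E)))).
  apply: ge0_le_integral => //.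
  - by apply: measurableT_comp => //; exact: measurable_bform.
  - by apply: measurable_funeM; apply: emeasurable_funD; [exact: mf|exact: mg].
  move=> p _; rewrite half_sum /= -EFinM lee_fin normrM ger0_norm// mulrCA.
  apply: ler_wpM2l => //; rewrite ler_norml.
  have := sqr_ge0 (w p.1 + w p.2)%R; have := sqr_ge0 (w p.1 - w p.2)%R.
  by nra.
rewrite integralZl//; last exact: integrableD.
rewrite integralD// integral_weight_fst// integral_weight_snd//.
have : \int[mu]_x ((w x ^+ 2)%:E * rowint x) \is a fin_num.
  by rewrite -integral_weight_fst//; exact: integrable_fin_num i1.
by move=> /fineK <-; rewrite -EFinD -EFinM lee_fin; lra.
Qed.

End finite.

Let sum_weights (c : R) w : (0 <= c)%R -> measurable_fun setT w ->
  \int[(mu \x mu)]_p (c%:E * ((K p * w p.1 ^+ 2)%:E + (K p * w p.2 ^+ 2)%:E))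
  <= (2 * c * C)%:E * sqint w.
Proof.
move=> c0 mw; rewrite ge0_integralZl//; last 2 first.
- by apply: emeasurable_funD; [exact: mf|exact: mg].
- by move=> p _; rewrite adde_ge0.
rewrite ge0_integralD//; [|exact: mf|exact: mg].
rewrite integral_weight_fst// integral_weight_snd//.
apply: (@le_trans _ _ (c%:E * (C%:E * sqint w + C%:E * sqint w))).
  by rewrite lee_wpmul2l ?lee_fin// leeD// rowint_weight_le.
rewrite -ge0_muleDl ?lee_fin// -EFinD muleA -EFinM.
by rewrite (_ : c * (C + C) = 2 * c * C)%R//; ring.
Qed.

(** With a = u - v and b = u + v, u(x) u(y) - v(x) v(y) is half of
    a(x) b(y) + b(x) a(y), and |a b| <= (t^-1 a^2 + t b^2) / 2. *)
Lemma bform_diff_le (t : R) u v : (0 < t)%R ->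
  measurable_fun setT u -> sqint u < +oo ->
  measurable_fun setT v -> sqint v < +oo ->
  `|bform K u - bform K v| <=
    (C / 2 * t^-1)%:E * sqint (u \- v)%R + (C / 2 * t)%:E * sqint (u \+ v)%R.
Proof.
move=> t0 mu_ u2 mv v2.
have ti0 : (0 < t^-1)%R by rewrite invr_gt0.
have iu := integrable_bform mu_ u2; have iv := integrable_bform mv v2.
pose a := (u \- v)%R; pose b := (u \+ v)%R.
have ma : measurable_fun setT a by exact: measurable_funB.
have mb : measurable_fun setT b by exact: measurable_funD.
have c1 : (0 <= 4^-1 * t^-1)%R by rewrite mulr_ge0// ltW.
have c2 : (0 <= 4^-1 * t)%R by rewrite mulr_ge0// ltW.
rewrite /bform -integralB//.
apply: le_trans (le_abse_integral _ _ _) _ => //.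
  by apply: emeasurable_funB; exact: measurable_bform.
apply: (@le_trans _ _ (\int[(mu \x mu)]_p
    ((4^-1 * t^-1)%:E * ((K p * a p.1 ^+ 2)%:E + (K p * a p.2 ^+ 2)%:E) +
     (4^-1 * t)%:E * ((K p * b p.1 ^+ 2)%:E + (K p * b p.2 ^+ 2)%:E)))).
  apply: ge0_le_integral => //.
  - apply: measurableT_comp => //.
    by apply: emeasurable_funB; exact: measurable_bform.
  - by apply: emeasurable_funD; apply: measurable_funeM; apply: emeasurable_funD;
      by [exact: mf|exact: mg].
  move=> p _; have hs w : (K p * w p.1 ^+ 2)%:E + (K p * w p.2 ^+ 2)%:E =
      (K p * (w p.1 ^+ 2 + w p.2 ^+ 2))%:E by rewrite -EFinD mulrDr.
  rewrite !hs -!EFinM -!EFinD /= lee_fin.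
  have -> : (K p * (u p.1 * u p.2) - K p * (v p.1 * v p.2) =
    K p * (2^-1 * (a p.1 * b p.2 + b p.1 * a p.2)))%R.
    by rewrite /a/b/=; field.
  rewrite normrM ger0_norm//.
  rewrite [leRHS](_ : _ = K p * (4^-1 * (t^-1 * (a p.1 ^+ 2 + a p.2 ^+ 2) +
      t * (b p.1 ^+ 2 + b p.2 ^+ 2))))%R; last by ring.
  apply: ler_wpM2l => //.
  have key (x y : R) : (`|x * y| <= 2^-1 * (t^-1 * x ^+ 2 + t * y ^+ 2))%R.
    rewrite ler_norml.
    have h1 : (0 <= t^-1 * (x + t * y) ^+ 2)%R by rewrite mulr_ge0 ?sqr_ge0// ltW.
    have h2 : (0 <= t^-1 * (x - t * y) ^+ 2)%R by rewrite mulr_ge0 ?sqr_ge0// ltW.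
    move: h1 h2.
    have -> : (t^-1 * (x + t * y) ^+ 2 = t^-1 * x ^+ 2 + 2 * (x * y) + t * y ^+ 2)%R.
      by field; rewrite gt_eqF.
    have -> : (t^-1 * (x - t * y) ^+ 2 = t^-1 * x ^+ 2 - 2 * (x * y) + t * y ^+ 2)%R.
      by field; rewrite gt_eqF.
    by move: (t^-1 * x ^+ 2)%R (t * y ^+ 2)%R (x * y)%R => A B D h1 h2;
      apply/andP; split; lra.
  rewrite normrM ger0_norm//.
  have := key (a p.1) (b p.2); have := key (a p.2) (b p.1).
  have := ler_normD (a p.1 * b p.2)%R (b p.1 * a p.2)%R.
  rewrite [(b p.1 * a p.2)%R]mulrC.
  move: `|a p.1 * b p.2 + a p.2 * b p.1|%R `|a p.1 * b p.2|%R.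
  by move: `|a p.2 * b p.1|%R (t^-1)%R => X ti Y Z; lra.
have h0 c w p : (0 <= c)%R ->
    0 <= c%:E * ((K p * w p.1 ^+ 2)%:E + (K p * w p.2 ^+ 2)%:E).
  by move=> ?; apply: mule_ge0; [rewrite lee_fin|exact: adde_ge0].
have hm c w : measurable_fun setT w -> measurable_fun [set: T * T]
    (fun p => c%:E * ((K p * w p.1 ^+ 2)%:E + (K p * w p.2 ^+ 2)%:E)).
  by move=> mw; apply: measurable_funeM; apply: emeasurable_funD; [exact: mf|exact: mg].
rewrite ge0_integralD//; [|by move=> p _; exact: h0|exact: hm|by move=> p _; exact: h0|exact: hm].
apply: leeD.
  apply: le_trans (sum_weights _ _) _ => //.
  by rewrite (_ : 2 * (4^-1 * t^-1) * C = C / 2 * t^-1)%R//; field; rewrite gt_eqF.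
apply: le_trans (sum_weights _ _) _ => //.
by rewrite (_ : 2 * (4^-1 * t) * C = C / 2 * t)%R//; field.
Qed.

End kernel.
End energy.

(** * Diagonal extraction *)
Lemma fmap_ultra (T U : Type) (f : T -> U) (G : set_system T) :
  UltraFilter G -> UltraFilter (f @ G).
Proof.
move=> GU; split; first exact: fmap_proper_filter.
move=> H HP GH; apply/seteqP; split => A; last exact: GH.
move=> HA; have [//|GN] := in_ultra_setVsetC (f @^-1` A) GU.
have /filter_ex[x []//] : H (A `&` ~` A) by apply: filterI => //; exact: GH.
Qed.

(** Along an ultrafilter finer than the Frechet filter every bounded sequence
    converges. Finitely many conditions of closeness to these limits hold on a
    set of the ultrafilter, which contains arbitrarily large indices; this
    gives the next term of the subsequence. *)
Lemma diagonal_extraction (R : realType) (I : countType) (a : I -> nat -> R) :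
  (forall i, exists B : R, forall n, `|a i n| <= B) ->
  exists k : nat -> nat, {homo k : i j / (i < j)%N} /\
    exists x : I -> R, forall i, a i (k n) @[n --> \oo] --> x i.
Proof.
move=> ab.
have [G [GU oG]] := @ultraFilterLemma nat \oo _.
have xex i : exists x : R, a i @ G --> x.
  have [B aB] := ab i.
  have := @segment_compact R (- B) B; rewrite compact_ultra.
  move=> /(_ (a i @ G) (fmap_ultra _ GU)) [|x [_ xG]]; last by exists x.
    have : G (a i @^-1` `[- B, B]).
      by apply: filterS filterT => n _; rewrite /= in_itv/= -ler_norml; exact: aB.
    by [].
have [x xG] := choice xex.
have next (c : nat * nat) : exists n, (c.1 < n)%N /\
    forall i, (pickle i <= c.2)%N -> `|x i - a i n| < c.2.+1%:R^-1.
  suff : G [set n | (c.1 < n)%N /\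
      forall i, (pickle i <= c.2)%N -> `|x i - a i n| < c.2.+1%:R^-1].
    by move=> /filter_ex[n]; exists n.
  apply: filterI; first by apply: oG; exists c.1.+1.
  have e0 : 0 < c.2.+1%:R^-1 :> R by [].
  move: (c.2.+1%:R^-1) e0 => e e0.
  have single i : G [set n | `|x i - a i n| < e].
    by have /cvgrPdist_lt/(_ e e0) := xG i.
  elim: c.2 => [|m IH].
    have [i0|none] := pselect (exists i : I, pickle i = 0%N).
      case: i0 => i i0; apply: filterS (single i) => n /= h i'.
      rewrite leqn0 => /eqP i'0; suff -> : i' = i by [].
      by apply: (pcan_inj pickleK); rewrite i0.
    apply: filterS filterT => n _ i; rewrite leqn0 => /eqP i0.
    by exfalso; apply: none; exists i.
  have [[i im]|none] := pselect (exists i : I, pickle i = m.+1).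
    apply: filterS (filterI (single i) IH) => n /= [h hm] i'.
    rewrite leq_eqVlt ltnS => /predU1P[i'm|]; last exact: hm.
    suff -> : i' = i by [].
    by apply: (pcan_inj pickleK); rewrite im.
  apply: filterS IH => n hm i; rewrite leq_eqVlt ltnS => /predU1P[im|]; last exact: hm.
  by exfalso; apply: none; exists i.
have [h hP] := choice next.
pose k := fix k (m : nat) : nat := if m is m'.+1 then h (k m', m'.+1) else h (0, 0)%N.
exists k; split.
  by apply: homo_ltn => [? ? ?|m /=]; [exact: ltn_trans|have [] := hP (k m, m.+1)].
exists x => i; apply/cvgrPdist_lt => e e0.
exists (maxn (pickle i) (Num.trunc e^-1)) => // m /=; rewrite geq_max => /andP[im em].
have : `|x i - a i (k m)| < m.+1%:R^-1.
  case: m im {em} => [|m] im.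
    by have [_] := hP (0, 0)%N; apply.
  by have [_] := hP (k m, m.+1); apply.
move=> /lt_le_trans; apply; rewrite -[leRHS]invrK lef_pV2 ?posrE ?invr_gt0//.
apply: le_trans (ltW (Num.Theory.truncnS_gt _)) _.
by rewrite ler_nat ltnS.
Qed.

(** * Completeness of L2 *)
Section limn_einf_bounds.
Context {R : realType}.
Local Open Scope ereal_scope.

Lemma limn_einf_ge_near (u : (\bar R)^nat) (l : \bar R) :
  (\forall n \near \oo, l <= u n) -> l <= limn_einf u.
Proof.
move=> [N _ lu]; rewrite limn_einf_lim; apply: lime_ge; first exact: is_cvg_einfs.
exists N => // n /= Nn; apply: le_ereal_inf_tmp => _ /= [k nk <-].
by apply: lu; exact: leq_trans nk.
Qed.

Lemma limn_einf_le_near (u : (\bar R)^nat) (l : \bar R) :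
  (\forall n \near \oo, u n <= l) -> limn_einf u <= l.
Proof.
move=> [N _ lu]; rewrite limn_einf_lim; apply: lime_le; first exact: is_cvg_einfs.
near=> n; apply: (@le_trans _ _ (u (maxn n N))); last first.
  by apply: lu => /=; rewrite leq_maxr.
by apply: ereal_inf_lbound; exists (maxn n N) => //=; rewrite leq_maxl.
Unshelve. all: by end_near. Qed.

End limn_einf_bounds.

Section completeness.
Context {R : realType} {dT : measure_display} {T : measurableType dT}.
Variable mu : {sigma_finite_measure set T -> \bar R}.
Local Open Scope ereal_scope.

Lemma summable_increments_cvg (g : nat -> R) :
  \sum_(j <oo) `|g j.+1 - g j|%:E < +oo -> cvgn g.
Proof.
move=> gfin; set S := \sum_(j <oo) _ in gfin.
have S0 : S \is a fin_num.
  by rewrite ge0_fin_numE//; apply: nneseries_ge0 => j _ _; rewrite lee_fin.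
have cs : cvgn (series (telescope g)).
  apply: normed_cvg; apply: nondecreasing_is_cvgn.
    apply: nondecreasing_series => n _ _; exact: normr_ge0.
  exists (fine S) => _ [n _ <-].
  rewrite -lee_fin fineK// /series/= -sumEFin.
  by apply: (@nneseries_lim_ge _ _ _ 0) => j _ _; rewrite lee_fin.
rewrite (_ : g = fun n => (g 0%N + series (telescope g) n)%R).
  by apply: is_cvgD => //; exact: is_cvg_cst.
by apply/funext => n; exact: eq_sum_telescope.
Qed.

(** The Riesz-Fischer theorem for functions supported in a set of finite
    measure. Along a subsequence g_j with squared distances at most 4^-j the
    increments are summable in L1, because
    |h| <= (2^j h^2 + 2^-j) / 2 on the support; so g_j converges almost
    everywhere, and Fatou's lemma turns the Cauchy property into convergence. *)
Lemma sqint_complete (O : set T) (f : nat -> T -> R) :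
  measurable O -> mu O < +oo ->
  (forall n, measurable_fun setT (f n)) ->
  (forall n x, ~ O x -> f n x = 0%R) ->
  (forall e : R, (0 < e)%R -> exists N, forall m n, (N <= m)%N -> (N <= n)%N ->
     sqint mu (f m \- f n)%R <= e%:E) ->
  exists v : T -> R, [/\ measurable_fun setT v, forall x, ~ O x -> v x = 0%R &
    forall e : R, (0 < e)%R -> exists N, forall n, (N <= n)%N ->
      sqint mu (f n \- v)%R <= e%:E].
Proof.
move=> mO Ofin mf fO fC.
have kex j : exists N, forall m n, (N <= m)%N -> (N <= n)%N ->
     sqint mu (f m \- f n)%R <= ((4^-1) ^+ j)%:E.
  by apply: fC; exact: exprn_gt0.
have [k kP] := choice kex.
(* the indices are summed so that they also increase and exceed j *)
pose kk j := (\sum_(i < j.+1) (k i).+1)%N.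
have kk_le j : (k j <= kk j)%N.
  by rewrite /kk big_ord_recr/= (leq_trans (leqnSn _))// leq_addl.
have kkS j : (kk j < kk j.+1)%N.
  by rewrite /kk [X in (_ < X)%N]big_ord_recr/= -addn1 leq_add.
have kk_id j : (j <= kk j)%N by elim: j => // j IH; exact: leq_ltn_trans (kkS j).
pose g j := f (kk j).
have mg j : measurable_fun setT (g j) by exact: mf.
have mh j : measurable_fun setT (fun x => `|g j.+1 x - g j x|%:E).
  apply/measurable_EFinP; apply: measurableT_comp => //.
  exact: measurable_funB.
pose A := fine (mu O).
have A0 : (0 <= A)%R by rewrite fine_ge0.
have AE : mu O = A%:E by rewrite fineK// ge0_fin_numE.
have hint j : \int[mu]_x `|g j.+1 x - g j x|%:E <= (((1 + A) / (2 ^ (j + 1))%:R)%R)%:E.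
  apply: (@le_trans _ _ (\int[mu]_x ((2^-1 * 2 ^+ j)%:E * ((g j.+1 \- g j)%R x ^+ 2)%:E
      + (2^-1 * (2^-1) ^+ j)%:E * (\1_O x)%:E))).
    apply: ge0_le_integral => //.
    - apply: emeasurable_funD; apply: measurable_funeM.
        by apply: measurable_sqr; exact: measurable_funB.
      exact/measurable_EFinP/measurable_indic.
    move=> x _; rewrite -!EFinM -EFinD lee_fin /= indicE.
    have [Ox|Ox] := pselect (O x); last first.
      by rewrite /g !fO// subrr normr0 memNset// expr0n/= !mulr0 addr0.
    rewrite mem_set// mulr1 exprVn.
    set a := `|_|%R; rewrite -[X in (_ * X + _)%R]real_normK ?num_real// -/a.
    have s0 : (0 < 2 ^+ j :> R)%R by rewrite exprn_gt0.
    have : (0 <= 2^-1 * (2 ^+ j)^-1 * (2 ^+ j * a - 1) ^+ 2)%R.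
      by apply: mulr_ge0; [apply: mulr_ge0; rewrite ?invr_ge0 ?ltW|exact: sqr_ge0].
    have -> : (2^-1 * (2 ^+ j)^-1 * (2 ^+ j * a - 1) ^+ 2 =
      2^-1 * 2 ^+ j * a ^+ 2 + 2^-1 * (2 ^+ j)^-1 - a)%R.
      by field; rewrite gt_eqF.
    by rewrite subr_ge0.
  have mgg : measurable_fun setT (fun x => ((g j.+1 \- g j)%R x ^+ 2)%:E).
    by apply: measurable_sqr; exact: measurable_funB.
  have mO1 : measurable_fun [set: T] (fun x => (\1_O x)%:E : \bar R).
    exact/measurable_EFinP/measurable_indic.
  have c0 : 0 <= (2^-1 * 2 ^+ j)%:E :> \bar R.
    by rewrite lee_fin mulr_ge0// exprn_ge0.
  have c1 : 0 <= (2^-1 * 2^-1 ^+ j)%:E :> \bar R.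
    by rewrite lee_fin mulr_ge0// exprn_ge0.
  have g0 x : setT x -> 0 <= ((g j.+1 \- g j)%R x ^+ 2)%:E.
    by move=> _; rewrite lee_fin sqr_ge0.
  have O0 x : setT x -> 0 <= (\1_O x)%:E :> \bar R by rewrite lee_fin.
  rewrite ge0_integralD; [|by []|by move=> x _; rewrite mule_ge0 ?g0|
    exact: measurable_funeM|by move=> x _; rewrite mule_ge0 ?O0|
    exact: measurable_funeM].
  rewrite ge0_integralZl// ge0_integralZl//.
  rewrite integral_indic// setIT [X in _ + _ * X <= _]AE -EFinM.
  rewrite -/(sqint mu (g j.+1 \- g j)%R).
  apply: (@le_trans _ _ ((2^-1 * 2 ^+ j)%:E * ((4^-1) ^+ j)%:E + (2^-1 * 2^-1 ^+ j * A)%:E)).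
    rewrite leeD2r// lee_wpmul2l//.
    by apply: kP => //; apply: leq_trans (ltnW (kkS j)).
  rewrite -EFinM -EFinD lee_fin addn1 natrX exprS.
  have -> : (4^-1 = 2^-1 * 2^-1 :> R)%R by field.
  rewrite exprMn !exprVn.
  have s0 : (0 < 2 ^+ j :> R)%R by rewrite exprn_gt0.
  move: (2 ^+ j)%R s0 => s s0.
  rewrite [leLHS](_ : _ = (1 + A) / (2 * s))%R//.
  by field; rewrite gt_eqF.
have ae : {ae mu, forall x, cvgn (fun j => g j x)}.
  have iS : mu.-integrable setT (fun x => \sum_(j <oo) `|g j.+1 x - g j x|%:E).
    apply/integrableP; split.
      apply: ge0_emeasurable_sum => //.
    rewrite (eq_integral (fun x => \sum_(j <oo) `|g j.+1 x - g j x|%:E)); last first.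
      by move=> x _; rewrite gee0_abs//; apply: nneseries_ge0 => j _ _; rewrite lee_fin.
    rewrite integral_nneseries//.
    apply: (@le_lt_trans _ _ (\sum_(j <oo) (((1 + A) / (2 ^ (j + 1))%:R)%R)%:E)).
      apply: lee_nneseries => // j _ _; exact: integral_ge0.
    by rewrite (cvg_lim _ (@cvg_geometric_eseries_half _ (1 + A)%R 0))// ltry.
  apply: filterS (integrable_ae measurableT iS) => x /(_ I).
  move=> /fin_numPlt/andP[_]; exact: summable_increments_cvg.
pose v x := fine (limn_esup (fun j => (g j x)%:E)).
have mv : measurable_fun setT v.
  apply: (measurableT_comp (fine_measurable _)) => //.
  by apply: measurable_fun_limn_esup => n; exact/measurable_EFinP.
have gv x : cvgn (fun j => g j x) -> g j x @[j --> \oo] --> v x.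
  move=> cg; have : (g j x)%:E @[j --> \oo] --> (limn (fun j => g j x))%:E.
    by apply: cvg_EFin => //; exact: nearW.
  by move=> /cvg_limn_einf_sup[_ E]; rewrite /v E.
exists v; split => //.
  move=> x Ox; rewrite /v.
  rewrite (_ : (fun j => _) = cst 0); last by apply/funext => j; rewrite /g fO.
  by rewrite (cvg_limn_einf_sup (cvg_cst 0)).2.
move=> e e0; have [N NP] := fC e e0; exists N => n Nn.
have mfg m : measurable_fun setT (fun x => ((f n x - g m x) ^+ 2)%:E).
  by apply: (@measurable_sqr _ _ _ (f n \- g m)%R); exact: measurable_funB.
rewrite /sqint (ae_eq_integral (fun x => limn_einf (fun j => ((f n x - g j x) ^+ 2)%:E)))//.
- apply: le_trans (fatou _ _ _ _) _ => //.
    by move=> m x _; rewrite lee_fin sqr_ge0.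
  apply: limn_einf_le_near; exists N => // m /= Nm; apply: NP => //.
  exact: leq_trans (kk_id m).
- by apply: measurable_sqr; exact: measurable_funB.
- have : measurable_fun setT (fun x => - limn_esup (fun j => - ((f n x - g j x) ^+ 2)%:E)).
    apply: (measurableT_comp (@oppe_measurable R setT)); apply: (measurable_fun_limn_esup (f := fun j x => _)) => j.
    exact: (measurableT_comp (@oppe_measurable R setT)).
  by [].
- apply: filterS ae => x /gv gx _; apply/esym.
  apply: (cvg_limn_einf_sup _).1.
  apply: cvg_EFin; first exact: nearW.
  by apply: cvgM; apply: cvgB => //; exact: cvg_cst.
Qed.

End completeness.

(** * Kernels built from cells *)
Section cell_kernel.
Context {R : realType} {dT : measure_display} {T : measurableType dT}.
Variable mu : {sigma_finite_measure set T -> \bar R}.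
Local Open Scope ereal_scope.

Definition cell_integral (Q : set T) (w : T -> R) : R :=
  fine (\int[mu]_x (\1_Q x * w x)%:E).

Section one_cell.
Variables (Q : set T) (m : R).
Hypothesis mQ : measurable Q.
Hypothesis muQ : mu Q = m%:E.

Lemma cell_measure_ge0 : (0 <= m)%R.
Proof. by rewrite -lee_fin -muQ measure_ge0. Qed.

Let integralQ : \int[mu]_x (\1_Q x)%:E = m%:E.
Proof. by rewrite integral_indic// setIT. Qed.

Lemma cell_integrable w : measurable_fun setT w -> sqint mu w < +oo ->
  mu.-integrable setT (fun x => (\1_Q x * w x)%:E) /\
  \int[mu]_x `|(\1_Q x * w x)%:E| <= sqint mu w + m%:E.
Proof.
move=> mw w2.
have mi : measurable_fun setT (fun x => (\1_Q x * w x)%:E).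
  by apply/measurable_EFinP/measurable_funM => //; exact: measurable_indic.
have le : \int[mu]_x `|(\1_Q x * w x)%:E| <= sqint mu w + m%:E.
  rewrite -integralQ /sqint -ge0_integralD//; last 3 first.
  - by move=> x _; rewrite lee_fin sqr_ge0.
  - exact: measurable_sqr.
  - exact/measurable_EFinP/measurable_indic.
  apply: ge0_le_integral => //.
  - exact: measurableT_comp.
  - apply: emeasurable_funD; first exact: measurable_sqr.
    exact/measurable_EFinP/measurable_indic.
  move=> x _; rewrite -EFinD /= lee_fin indicE.
  case: (x \in Q) => /=; rewrite ?mul1r ?mul0r ?normr0 ?addr0 ?sqr_ge0//.
  rewrite -[(w x ^+ 2)%R]real_normK ?num_real//.
  move: `|w x|%R (normr_ge0 (w x)) => a a0.
  by have := sqr_ge0 (a - 1)%R; have := sqr_ge0 a; lra.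
split=> //; apply/integrableP; split => //.
by apply: le_lt_trans le _; rewrite lte_add_pinfty// ltry.
Qed.

Lemma cell_integral_bounded w : measurable_fun setT w -> sqint mu w < +oo ->
  (`|cell_integral Q w|%:E <= sqint mu w + m%:E)%E.
Proof.
move=> mw w2; have [iw le] := cell_integrable mw w2.
apply: le_trans le; rewrite /cell_integral.
have fi := integrable_fin_num measurableT iw.
rewrite -abse_EFin fineK//; apply: le_abse_integral => //.
by case/integrableP : iw.
Qed.

Lemma cell_integralB u v : measurable_fun setT u -> sqint mu u < +oo ->
  measurable_fun setT v -> sqint mu v < +oo ->
  cell_integral Q (u \- v)%R = (cell_integral Q u - cell_integral Q v)%R.
Proof.
move=> mu_ u2 mv v2.
have [iu _] := cell_integrable mu_ u2; have [iv _] := cell_integrable mv v2.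
rewrite /cell_integral -fineB ?integrable_fin_num// -integralB//.
by congr fine; apply: eq_integral => x _; rewrite -EFinB -mulrBr.
Qed.

Let K (p : T * T) : R := (\1_Q p.1 * \1_Q p.2)%R.

Lemma cell_bform_integrable w : measurable_fun setT w -> sqint mu w < +oo ->
  (mu \x mu).-integrable setT (fun p => (\1_Q p.1 * \1_Q p.2 * (w p.1 * w p.2))%:E).
Proof.
move=> mw w2.
have mK : measurable_fun setT K.
  by apply: measurable_funM; [exact: (measurable_fst_comp (measurable_indic mQ))|
    exact: (measurable_snd_comp (measurable_indic mQ))].
apply: (@integrable_bform _ _ _ mu K _ mK _ m) => //.
  - by move=> p; rewrite mulr_ge0.
  - by move=> x y; rewrite /K mulrC.
  - exact: cell_measure_ge0.
  - move=> x; rewrite /rowint /K -integralQ; apply: ge0_le_integral => //.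
    + apply/measurable_EFinP; apply: measurable_funM => //=; exact: measurable_indic.
    + exact/measurable_EFinP/measurable_indic.
    + move=> y _; rewrite lee_fin /= ler_piMl// indicE; by case: (_ \in _).
Qed.

(** The kernel is a product, so Fubini's theorem gives a square. *)
Lemma cell_bform w : measurable_fun setT w -> sqint mu w < +oo ->
  bform mu (fun p => \1_Q p.1 * \1_Q p.2)%R w = (cell_integral Q w ^+ 2)%:E.
Proof.
move=> mw w2; have [iw _] := cell_integrable mw w2.
have fi := integrable_fin_num measurableT iw.
have iK := cell_bform_integrable mw w2.
rewrite /bform -integral12_prod_meas1// /fubini_F /=.
transitivity (\int[mu]_x ((cell_integral Q w)%:E * (\1_Q x * w x)%:E)).
  apply: eq_integral => x _.
  transitivity (\int[mu]_y ((\1_Q x * w x)%:E * (\1_Q y * w y)%:E)).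
    by apply: eq_integral => y _; rewrite -EFinM /=; congr EFin; ring.
  by rewrite integralZl// muleC /cell_integral fineK.
by rewrite integralZl// -[X in _ * X]fineK// -EFinM expr2.
Qed.

End one_cell.

Variables (I : finType) (Q : I -> set T) (m c : I -> R).
Hypothesis mQ : forall i, measurable (Q i).
Hypothesis muQ : forall i, mu (Q i) = (m i)%:E.
Hypothesis c0 : forall i, (0 <= c i)%R.

Definition cell_kernel (p : T * T) : R :=
  (\sum_i c i * (\1_(Q i) p.1 * \1_(Q i) p.2))%R.

Lemma cell_kernel_ge0 p : (0 <= cell_kernel p)%R.
Proof. by apply: sumr_ge0 => i _; rewrite !mulr_ge0. Qed.

Lemma measurable_cell_kernel : measurable_fun setT cell_kernel.
Proof.
apply: measurable_sum => i; apply: measurable_funM => //.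
by apply: measurable_funM; [exact: (measurable_fst_comp (measurable_indic (mQ i)))|
    exact: (measurable_snd_comp (measurable_indic (mQ i)))].
Qed.

Lemma cell_kernel_sym x y : cell_kernel (x, y) = cell_kernel (y, x).
Proof. by apply: eq_bigr => i _; rewrite /= [X in (_ * X)%R]mulrC. Qed.

Lemma rowint_cell_kernel x :
  rowint mu cell_kernel x = (\sum_i c i * m i * \1_(Q i) x)%:E.
Proof.
rewrite /rowint /cell_kernel.
under eq_integral do rewrite -sumEFin.
rewrite ge0_integral_sum//; last 2 first.
- move=> i; apply/measurable_EFinP; do 2 apply: measurable_funM => //=.
- by move=> i y _; rewrite lee_fin !mulr_ge0.
rewrite -sumEFin; apply: eq_bigr => i _.
transitivity (\int[mu]_y ((c i * \1_(Q i) x)%:E * (\1_(Q i) y)%:E)).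
  by apply: eq_integral => y _; rewrite -EFinM mulrA.
rewrite ge0_integralZl//; last 2 first.
- exact/measurable_EFinP/measurable_indic.
- by rewrite lee_fin mulr_ge0.
rewrite integral_indic// setIT [X in _ * X]muQ -EFinM.
by congr EFin; ring.
Qed.

(** Instance of [energy_bform]: the rows of the kernel have mass N wherever w
    does not vanish, and its bilinear form only sees the integrals of w over the
    cells. A large N thus controls the norm of w by its energy and finitely many
    numbers. *)
Lemma sqint_cell_kernel w (N : R) : (0 <= N)%R -> measurable_fun setT w -> sqint mu w < +oo ->
  (forall x, w x != 0%R -> (\sum_i c i * m i * \1_(Q i) x)%R = N) ->
  N%:E * sqint mu w = 2^-1%:E * energy mu cell_kernel w +
    (\sum_i c i * cell_integral (Q i) w ^+ 2)%:E.
Proof.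
move=> N0 mw w2 wN.
have rowC x : rowint mu cell_kernel x <= (\sum_i c i * m i)%:E.
  rewrite rowint_cell_kernel lee_fin; apply: ler_sum => i _.
  apply: ler_piMr; first by rewrite mulr_ge0// (cell_measure_ge0 (muQ i)).
  by rewrite indicE; case: (_ \in _).
have C0 : (0 <= \sum_i c i * m i)%R.
  by apply: sumr_ge0 => i _; rewrite mulr_ge0// (cell_measure_ge0 (muQ i)).
have bE : bform mu cell_kernel w = (\sum_i c i * cell_integral (Q i) w ^+ 2)%:E.
  rewrite /bform.
  pose Ki i (p : T * T) : R := (\1_(Q i) p.1 * \1_(Q i) p.2)%R.
  transitivity (\int[(mu \x mu)]_p (\sum_i (c i)%:E * (Ki i p * (w p.1 * w p.2))%:E)).
    apply: eq_integral => p _; rewrite /cell_kernel mulr_suml -sumEFin.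
    by apply: eq_bigr => i _; rewrite -EFinM -mulrA.
  have iKi i : (mu \x mu).-integrable setT (fun p => (Ki i p * (w p.1 * w p.2))%:E).
    by have H := cell_bform_integrable (mQ i) (muQ i) mw w2; exact: H.
  rewrite integral_sum//; last by move=> i; exact: integrableZl.
  rewrite -sumEFin; apply: eq_bigr => i _.
  by rewrite integralZl// -/(bform mu (Ki i) w) (cell_bform (mQ i) (muQ i)).
rewrite (energy_bform cell_kernel_ge0 measurable_cell_kernel cell_kernel_sym C0 rowC mw w2).
rewrite bE subeK//.
rewrite /sqint -ge0_integralZl//; last 2 first.
- exact: measurable_sqr.
- by move=> x _; rewrite lee_fin sqr_ge0.
apply: eq_integral => x _; rewrite rowint_cell_kernel.
have [->|wx] := eqVneq (w x) 0%R; first by rewrite expr0n/= mule0 mul0e.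
by rewrite wN// muleC.
Qed.

End cell_kernel.

(** * Dyadic cubes *)
Section dyadic_cubes.
Context {R : realType} (n : nat) (B : R).
Hypothesis n0 : (0 < n)%N.
Hypothesis B0 : 0 < B.
Local Notation mu := (@lebesgue_row R n).

Definition side j : R := 2 * B / 2 ^+ j.

Lemma side_gt0 j : 0 < side j.
Proof. by rewrite /side divr_gt0 ?mulr_gt0// exprn_gt0. Qed.

Lemma sideS j : side j = 2 * side j.+1.
Proof. by rewrite /side exprS; field; rewrite expf_neq0. Qed.

Lemma side_le i j : (i <= j)%N -> side j <= side i.
Proof.
move=> ij; rewrite /side ler_pM2l ?mulr_gt0// lef_pV2 ?posrE ?exprn_gt0//.
by rewrite ler_weXn2l// ler1n.
Qed.

Definition cube j (q : {ffun 'I_n -> 'I_(2 ^ j)}) : set 'rV[R]_n :=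
  [set x | forall i,
    `[- B + (q i)%:R * side j, - B + (q i).+1%:R * side j[%classic (x ord0 i)].

Lemma measurable_cube j q : measurable (@cube j q).
Proof.
apply: (@measurable_cylinder _ _ (fun i =>
  `[- B + (q i)%:R * side j, - B + (q i).+1%:R * side j[%classic)) => i.
exact: measurable_itv.
Qed.

Lemma lebesgue_row_cube j q : mu (@cube j q) = (side j ^+ n)%:E.
Proof.
rewrite (@lebesgue_row_box _ _ (fun i =>
  `[- B + (q i)%:R * side j, - B + (q i).+1%:R * side j[%classic)); last first.
  by move=> i; exact: measurable_itv.
rewrite (eq_bigr (fun=> (side j)%:E)).
  by rewrite prodEFin prodr_const card_ord.
move=> i _; rewrite lebesgue_measure_itv/= lte_fin ltrD2l ltr_pM2r ?side_gt0//.
rewrite ltr_nat ltnSn -EFinB; congr EFin.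
by rewrite -natr1; ring.
Qed.

Lemma cubeE j (q : {ffun 'I_n -> 'I_(2 ^ j)}) (x : 'rV[R]_n) :
  cube q x <->
  forall i, (q i)%:R <= (x ord0 i + B) / side j < (q i).+1%:R.
Proof.
have s0 := side_gt0 j.
split=> xq i; have := xq i; rewrite /= in_itv/= ler_pdivlMr// ltr_pdivrMr//.
  by move=> /andP[? ?]; apply/andP; split; lra.
by move=> /andP[? ?]; apply/andP; split; lra.
Qed.

Lemma cube_inj j (q q' : {ffun 'I_n -> 'I_(2 ^ j)}) (x : 'rV[R]_n) :
  cube q x -> cube q' x -> q = q'.
Proof.
move=> /cubeE xq /cubeE xq'; apply/ffunP => i; apply/val_inj => /=.
by rewrite -(Num.Theory.truncn_def (xq i)) (Num.Theory.truncn_def (xq' i)).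
Qed.

Lemma cube_partition j (x : 'rV[R]_n) : (forall i, `|x ord0 i| < B) ->
  \sum_(q : {ffun 'I_n -> 'I_(2 ^ j)}) \1_(cube q) x = 1 :> R.
Proof.
move=> xB; have s0 := side_gt0 j.
pose t i := Num.trunc ((x ord0 i + B) / side j).
have y0 i : 0 <= (x ord0 i + B) / side j.
  rewrite divr_ge0 ?(ltW s0)//; have := xB i; rewrite ltr_norml => /andP[]; lra.
have tP i : (t i)%:R <= (x ord0 i + B) / side j < (t i).+1%:R.
  exact: Num.Theory.truncn_itv.
have t2 i : (t i < 2 ^ j)%N.
  rewrite Num.Theory.truncn_lt_nat// ltr_pdivrMr// natrX /side.
  rewrite mulrC divfK ?expf_neq0//.
  by have := xB i; rewrite ltr_norml => /andP[]; lra.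
pose q0 : {ffun 'I_n -> 'I_(2 ^ j)} := [ffun i => Ordinal (t2 i)].
have xq0 : cube q0 x by apply/cubeE => i; rewrite ffunE; exact: tP.
rewrite (bigD1 q0)//= big1 ?addr0; first by rewrite indicE mem_set.
move=> q qq0; rewrite indicE memNset// => xq; case/eqP: qq0.
exact: cube_inj xq xq0.
Qed.

Lemma cube_enorm j q (x y : 'rV[R]_n) : @cube j q x -> cube q y ->
  enorm (x - y) <= Num.sqrt n%:R * side j.
Proof.
move=> xq yq; apply: enorm_le_coord; first exact/ltW/side_gt0.
move=> i; rewrite !mxE ler_norml.
have := xq i; have := yq i; rewrite /= !in_itv/= -natr1.
by move=> /andP[? ?] /andP[? ?]; apply/andP; split; lra.
Qed.

Definition same_cube j (p : 'rV[R]_n * 'rV[R]_n) : R :=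
  \sum_(q : {ffun 'I_n -> 'I_(2 ^ j)}) \1_(cube q) p.1 * \1_(cube q) p.2.

Lemma same_cubeP j p : same_cube j p = 0 \/
  (same_cube j p = 1 /\ enorm (p.1 - p.2) <= Num.sqrt n%:R * side j).
Proof.
have [[q [q1 q2]]|none] := pselect (exists q, @cube j q p.1 /\ cube q p.2).
  right; split; last exact: cube_enorm q1 q2.
  rewrite /same_cube (bigD1 q)//= big1 ?addr0.
    by rewrite !indicE !mem_set// mulr1.
  move=> q' q'q; rewrite indicE memNset ?mul0r// => q'1; case/eqP: q'q.
  exact: cube_inj q'1 q1.
left; rewrite /same_cube big1// => q _; rewrite !indicE.
have [q1|] := boolP (p.1 \in cube q); last by rewrite mul0r.
have [q2|] := boolP (p.2 \in cube q); last by rewrite mulr0.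
by exfalso; apply: none; exists q; split; [rewrite inE in q1|rewrite inE in q2].
Qed.

(** Each scale is normalised so that its rows have mass 1 in the box. *)
Definition scale_kernel j0 N p : R :=
  \sum_(j < N) (side (j0 + j) ^+ n)^-1 * same_cube (j0 + j) p.

(** The side is halved from one scale to the next, so the finest scale dominates
    the geometric sum; this is why the bound does not depend on [N]. *)
Lemma scale_kernel_le_side j0 N p :
  scale_kernel j0 N.+1 p <= 2 * (side (j0 + N) ^+ n)^-1.
Proof.
have s1 j : same_cube j p <= 1 by case: (same_cubeP j p) => [->|[->]].
have h0 j : 0 < (side j ^+ n)^-1 by rewrite invr_gt0 exprn_gt0// side_gt0.
elim: N => [|N IH].
  rewrite /scale_kernel big_ord_recr/= big_ord0 add0r.
  by have := h0 (j0 + 0)%N; have := s1 (j0 + 0)%N; nra.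
rewrite /scale_kernel big_ord_recr/= -/(scale_kernel j0 N.+1 p).
have hS : 2 * (side (j0 + N) ^+ n)^-1 <= (side (j0 + N.+1) ^+ n)^-1.
  rewrite addnS sideS exprMn invfM mulrA ler_piMl ?(ltW (h0 _))//.
  rewrite ler_pdivrMr ?exprn_gt0// mul1r -[leLHS]expr1 ler_weXn2l// ler1n//.
by have := h0 (j0 + N.+1)%N; have := s1 (j0 + N.+1)%N; nra.
Qed.

(** If j is the finest scale at which the two points share a cube, their
    distance is at most sqrt n times the side h of that scale, so the Riesz kernel
    is at least (sqrt n h)^(a - n). The condition on [a] says that
    (sqrt n h)^a >= 1/2 at all scales up to the last one. *)
Lemma scale_kernel_le_riesz j0 N (a : R) p :
  Num.sqrt n%:R * side j0 <= 1 -> 0 <= a <= n%:R ->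
  2^-1 <= (Num.sqrt n%:R * side (j0 + N)) `^ a ->
  p.1 != p.2 ->
  scale_kernel j0 N p <= 4 * Num.sqrt n%:R ^+ n * (\1_(@D1 R n) p * riesz a p).
Proof.
move=> s1 /andP[a0 an]; have r0 : 0 < Num.sqrt n%:R :> R by rewrite sqrtr_gt0 ltr0n.
move=> + pp; have z0 := enorm_sub_gt0 pp.
elim: N => [|N IH] hN.
  rewrite /scale_kernel big_ord0 !mulr_ge0 ?powR_ge0// exprn_ge0// ltW//.
set tau := Num.sqrt n%:R * side (j0 + N).
have tau0 : 0 < tau by rewrite mulr_gt0// side_gt0.
have htau : 2^-1 <= tau `^ a.
  have ts0 j : 0 <= Num.sqrt n%:R * side j by rewrite ltW// mulr_gt0// side_gt0.
  apply: le_trans hN _; apply: ge0_ler_powR => //; rewrite ?nnegrE ?ts0//.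
  by rewrite /tau ler_pM2l// side_le// leq_add2l.
have [E|[_ zt]] := same_cubeP (j0 + N) p.
  by rewrite /scale_kernel big_ord_recr/= E mulr0 addr0; exact: IH.
apply: le_trans (scale_kernel_le_side _ _ _) _.
have z1 : enorm (p.1 - p.2) <= 1.
  by apply: le_trans zt (le_trans _ s1); rewrite ler_pM2l// side_le// leq_addr.
rewrite indicE mem_set//= mul1r.
have : tau `^ (a - n%:R) <= riesz a p.
  rewrite /riesz -[a - _]opprB !powRN lef_pV2 ?posrE ?powR_gt0//.
  by apply: ge0_ler_powR; rewrite ?nnegrE ?subr_ge0// ltW.
have -> : tau `^ (a - n%:R) = tau `^ a * (Num.sqrt n%:R ^+ n)^-1 * (side (j0 + N) ^+ n)^-1.
  rewrite powRD ?(gt_eqF tau0) ?implybT// powRN powR_mulrn ?ltW// /tau exprMn invfM.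
  by rewrite mulrA.
have r1 : 0 < Num.sqrt n%:R ^+ n :> R by rewrite exprn_gt0.
have h0 : 0 < (side (j0 + N) ^+ n)^-1 by rewrite invr_gt0 exprn_gt0// side_gt0.
move: (riesz a p) (side _ ^+ n)^-1 h0 (tau `^ a) htau (Num.sqrt n%:R ^+ n) r1.
move=> k h h0 t ht r rgt0 le.
apply: (@le_trans _ _ (4 * r * (t * r^-1 * h))); last by rewrite ler_pM2l// mulr_gt0.
have -> : 4 * r * (t * r^-1 * h) = 4 * t * h by field; rewrite gt_eqF.
by rewrite ler_pM2r//; lra.
Qed.

End dyadic_cubes.

(** * Relative compactness from bounded energies *)
Lemma cvg_finite_sum (R : realType) (I : Type) (r : seq I) (f : I -> nat -> R)
    (l : I -> R) : (forall i, f i n @[n --> \oo] --> l i) ->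
  \sum_(i <- r) f i n @[n --> \oo] --> \sum_(i <- r) l i.
Proof.
move=> fl; elim: r => [|i r IH].
  by rewrite big_nil; under eq_fun do rewrite big_nil; exact: cvg_cst.
rewrite big_cons; under eq_fun do rewrite big_cons.
by apply: cvgD => //; exact: fl.
Qed.

Lemma powR_exponent_cvg (R : realType) (t : R) (a : nat -> R) (l : R) : 0 < t ->
  a n @[n --> \oo] --> l -> t `^ (a n) @[n --> \oo] --> t `^ l.
Proof.
move=> t0 al; rewrite /powR gt_eqF//.
apply: (cvg_comp (fun n => a n * ln t) expR); last exact: continuous_expR.
by apply: cvgM => //; exact: cvg_cst.
Qed.

Section compactness.
Context {R : realType} (n : nat) (B : R).
Hypothesis n0 : (0 < n)%N.
Hypothesis B0 : 0 < B.
Local Notation mu := (@lebesgue_row R n).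
Section scales.
Variables (j0 N : nat).
Local Notation I := {j : 'I_N & {ffun 'I_n -> 'I_(2 ^ (j0 + j))}}.

(** The family of all cubes of the scales j0, ..., j0 + N - 1, which presents
    [scale_kernel] as a [cell_kernel]. *)
Definition scale_cube (i : I) : set 'rV[R]_n := cube B (tagged i).
Definition scale_weight (i : I) : R := (side B (j0 + tag i) ^+ n)^-1.

Lemma scale_kernelE p :
  cell_kernel scale_cube scale_weight p = scale_kernel B j0 N p.
Proof.
rewrite /cell_kernel /scale_kernel.
under [RHS]eq_bigr do rewrite /same_cube mulr_sumr.
by rewrite (sig_big_dep _ _ (fun (j : 'I_N) (q : {ffun 'I_n -> 'I_(2 ^ (j0 + j))}) =>
  (side B (j0 + j) ^+ n)^-1 * (\1_(cube B q) p.1 * \1_(cube B q) p.2))).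
Qed.

Lemma scale_cube_sum (x : 'rV[R]_n) : (forall i, `|x ord0 i| < B) ->
  \sum_(i : I) scale_weight i * side B (j0 + tag i) ^+ n * \1_(scale_cube i) x = N%:R.
Proof.
move=> xB.
transitivity (\sum_(j < N) \sum_(q : {ffun 'I_n -> 'I_(2 ^ (j0 + j))})
  (side B (j0 + j) ^+ n)^-1 * side B (j0 + j) ^+ n * \1_(cube B q) x).
  by rewrite sig_big_dep.
rewrite (eq_bigr (fun=> 1)) ?sumr_const ?card_ord// => j _.
by rewrite -mulr_sumr cube_partition// mulr1 mulVf// expf_neq0// gt_eqF// side_gt0.
Qed.

End scales.

Lemma first_scale : exists j0, Num.sqrt n%:R * side B j0 <= 1.
Proof.
pose X := Num.sqrt n%:R * (2 * B).
exists (Num.trunc X).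
rewrite /side mulrA ler_pdivrMr ?exprn_gt0// mul1r.
apply: le_trans (ltW (Num.Theory.truncnS_gt X)) _.
by rewrite -natrX ler_nat ltn_expl.
Qed.

(** Given e, the number N of scales is chosen with (2 C E + 1) / N <= e: for late
    terms the energy of a difference contributes at most 2 C E, and the integrals
    over the finitely many cubes of these N scales contribute at most 1. *)
Lemma sqint_cauchy_subsequence (alpha : nat -> R) (u : nat -> 'rV[R]_n -> R) (A E : R) :
  (forall k, 0 <= alpha k <= n%:R) -> alpha k @[k --> \oo] --> 0 ->
  (forall k, measurable_fun setT (u k)) ->
  (forall k x, u k x != 0 -> forall i, `|x ord0 i| < B) ->
  (forall k, sqint mu (u k) <= A%:E)%E ->
  (forall k, energy mu (near_kernel (alpha k)) (u k) <= E%:E)%E ->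
  exists phi : nat -> nat, {homo phi : i j / (i < j)%N} /\
    forall e : R, 0 < e -> exists M, forall k l, (M <= k)%N -> (M <= l)%N ->
      (sqint mu (u (phi k) \- u (phi l))%R <= e%:E)%E.
Proof.
move=> a01 a0 mu_ uB uA uE.
have u2 k : (sqint mu (u k) < +oo)%E by apply: le_lt_trans (uA k) (ltry _).
pose I := {j : nat & {ffun 'I_n -> 'I_(2 ^ j)}}.
have [i|phi [phimon [x phix]]] := @diagonal_extraction R I
    (fun i k => cell_integral mu (cube B (tagged i)) (u k)).
  exists (A + side B (tag i) ^+ n) => k.
  rewrite -lee_fin; have mQ := measurable_cube B (tagged i).
  apply: le_trans (cell_integral_bounded mQ (lebesgue_row_cube B0 (tagged i)) (mu_ k) (u2 k)) _.
  by rewrite EFinD leeD2r.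
exists phi; split => // e e0.
have [j0 hj0] := first_scale.
pose C := 4 * Num.sqrt n%:R ^+ n : R.
have C0 : 0 <= C by rewrite mulr_ge0// exprn_ge0// sqrtr_ge0.
have E0 : 0 <= E.
  rewrite -lee_fin; apply: le_trans (uE 0%N); apply: energy_ge0 => p.
  exact: near_kernel_ge0.
pose N := (Num.trunc ((2 * (C * E) + 1) / e)).+1.
have Ne : (2 * (C * E) + 1) / N%:R <= e.
  rewrite ler_pdivrMr ?ltr0n// [leRHS]mulrC -ler_pdivrMr//.
  exact/ltW/Num.Theory.truncnS_gt.
pose IN := {j : 'I_N & {ffun 'I_n -> 'I_(2 ^ (j0 + j))}}.
pose Q := @scale_cube j0 N; pose c := @scale_weight j0 N.
pose m (i : IN) := side B (j0 + tag i) ^+ n.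
have mQ i : measurable (Q i) by exact: measurable_cube.
have muQ i : mu (Q i) = (m i)%:E by exact: lebesgue_row_cube.
have c0 i : 0 <= c i by rewrite invr_ge0 exprn_ge0// ltW// side_gt0.
pose K := cell_kernel Q c.
have K0 := cell_kernel_ge0 Q c0.
have mK := measurable_cell_kernel c mQ.
pose a (i : IN) k := cell_integral mu (Q i) (u (phi k)).
have phi_ge k : (k <= phi k)%N.
  by elim: k => // k IH; apply: leq_ltn_trans IH (phimon _ _ _).
have [M1 M1P] : exists M, forall k, (M <= k)%N ->
    (energy mu K (u (phi k)) <= (C * E)%:E)%E.
  have tau0 : 0 < Num.sqrt n%:R * side B (j0 + N).
    by rewrite mulr_gt0 ?sqrtr_gt0 ?ltr0n// side_gt0.
  have := powR_exponent_cvg tau0 a0; rewrite powRr0.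
  move=> /cvgr_ge/(_ (2^-1)) [|M _ MP]; first lra.
  exists M => k Mk; apply: le_trans (_ : C%:E * energy mu (near_kernel (alpha (phi k))) (u (phi k)) <= _)%E.
    have mn := measurable_near_kernel (n := n) (alpha (phi k)).
    rewrite /energy -ge0_integralZl//; last 2 first.
    - exact: measurable_energy.
    - by move=> p _; rewrite lee_fin mulr_ge0 ?near_kernel_ge0// sqr_ge0.
    apply: ge0_le_integral => //.
    - by move=> p _; rewrite lee_fin mulr_ge0 ?K0// sqr_ge0.
    - exact: measurable_energy.
    - by apply: measurable_funeM; exact: measurable_energy.
    move=> p _; rewrite -EFinM lee_fin [leRHS]mulrA.
    have [pp|pp] := eqVneq p.1 p.2.
      by rewrite pp subrr expr0n/= !mulr0.
    apply: ler_wpM2r; first exact: sqr_ge0.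
    rewrite /K scale_kernelE; apply: scale_kernel_le_riesz => //.
    by apply: MP => /=; apply: leq_trans Mk (phi_ge k).
  by rewrite [leRHS]EFinM lee_wpmul2l.
pose toI (i : IN) : I := Tagged (fun j => {ffun 'I_n -> 'I_(2 ^ j)}) (tagged i).
pose xN i := x (toI i).
have ax i : a i k @[k --> \oo] --> xN i by exact: (phix (toI i)).
have [M2 M2P] : exists M, forall k, (M <= k)%N ->
    \sum_i c i * (a i k - xN i) ^+ 2 <= 4^-1.
  have : \sum_i c i * (a i k - xN i) ^+ 2 @[k --> \oo] --> \sum_i c i * 0.
    apply: cvg_finite_sum => i; apply: cvgM; first exact: cvg_cst.
    have h : a i k - xN i @[k --> \oo] --> 0.
      by rewrite -(subrr (xN i)); apply: cvgB; [exact: ax|exact: cvg_cst].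
    by rewrite -(mulr0 0); exact: (cvgM h h).
  rewrite big1 ?mulr0//; last by move=> i _; rewrite mulr0.
  move=> /cvgr_le/(_ (4^-1)) [|M _ MP]; first lra.
  by exists M => k Mk; exact: MP.
exists (maxn M1 M2) => k l; rewrite !geq_max => /andP[k1 k2] /andP[l1 l2].
set w := (_ \- _).
have mw : measurable_fun setT w by exact: measurable_funB.
have w2 : (sqint mu w < +oo)%E.
  apply: le_lt_trans (sqintB_le mu (mu_ _) (mu_ _)) _.
  by rewrite lte_add_pinfty// lte_mul_pinfty.
have wN y : w y != 0 -> \sum_i c i * m i * \1_(Q i) y = N%:R.
  move=> wy; apply: scale_cube_sum => i.
  have [uk|uk] := eqVneq (u (phi k) y) 0; last exact: uB uk i.
  have [ul|ul] := eqVneq (u (phi l) y) 0; last exact: uB ul i.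
  by move: wy; rewrite /w /= uk ul subrr eqxx.
have := sqint_cell_kernel mQ muQ c0 (ler0n _ N) mw w2 wN.
have fw : sqint mu w \is a fin_num by rewrite ge0_fin_numE// sqint_ge0.
have Kw : (energy mu K w <= (4 * (C * E))%:E)%E.
  apply: le_trans (energyB_le mu K0 mK (mu_ _) (mu_ _)) _.
  rewrite (_ : 4 * (C * E) = 2 * (C * E) + 2 * (C * E)); last by ring.
  by rewrite [leRHS]EFinD; apply: leeD; rewrite [leRHS]EFinM lee_wpmul2l// M1P.
have Sw : \sum_i c i * cell_integral mu (Q i) w ^+ 2 <= 1.
  apply: (@le_trans _ _ (\sum_i (2 * (c i * (a i k - xN i) ^+ 2) +
      2 * (c i * (a i l - xN i) ^+ 2)))).
    apply: ler_sum => i _; rewrite (cell_integralB (mQ i) (muQ i))//.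
    rewrite -/(a i k) -/(a i l) [leRHS](_ : _ =
      c i * (2 * (a i k - xN i) ^+ 2 + 2 * (a i l - xN i) ^+ 2)); last by ring.
    apply: ler_wpM2l => //.
    by have := sqr_ge0 (a i k - xN i + (a i l - xN i)); lra.
  rewrite big_split/= -!mulr_sumr.
  by have := M2P k k2; have := M2P l l2; lra.
have fK : energy mu K w \is a fin_num.
  rewrite ge0_fin_numE ?energy_ge0//.
  by apply: le_lt_trans Kw (ltry _).
rewrite -(fineK fw) -(fineK fK) -!EFinM -EFinD => -[NE].
rewrite lee_fin; apply: le_trans Ne; rewrite ler_pdivlMr ?ltr0n// mulrC NE.
by move: Kw; rewrite -(fineK fK) lee_fin; lra.
Qed.

End compactness.

(** * The functionals as quadratic forms *)
Section functionals_as_kernels.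
Context {R : realType} (n : nat).
Hypothesis n0 : (0 < n)%N.
Variable Omega : set 'rV[R]_n.
Hypothesis mOmega : measurable Omega.
Hypothesis finOmega : (@lebesgue_row R n Omega < +oo)%E.
Local Notation mu := (@lebesgue_row R n).
Local Notation ext u := (u \_ Omega).
Local Open Scope ereal_scope.
Implicit Types (u v w : 'rV[R]_n -> R).

Definition far_kernel (a : R) (p : 'rV[R]_n * 'rV[R]_n) : R :=
  (\1_((Omega `*` Omega) `\` @D1 R n) p * riesz a p)%R.

Lemma poweR_sqr (x : \bar R) : 0 <= x -> x `^ 2 = x ^+ 2.
Proof.
case: x => [r r0| _|//]; last by rewrite poweRyr// expeS mulyy.
by rewrite poweR_EFin powR_mulrn// EFin_expe.
Qed.

Lemma L2norm_sqr u : L2norm Omega u ^+ 2 = sqint mu (ext u).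
Proof.
rewrite -poweR_sqr ?Lnorm_ge0// powR_Lnorm// /sqint.
apply: eq_integral => x _ /=; rewrite powR_mulrn// real_normK ?num_real//.
Qed.

Lemma extB u v : ext (u \- v)%R = (ext u \- ext v)%R.
Proof.
by apply/funext => x; rewrite /= !patchE; case: ifP => // _; rewrite subrr.
Qed.

Lemma ext_out u x : ~ Omega x -> (ext u) x = 0%R.
Proof. by move=> Ox; rewrite patchE memNset. Qed.

Lemma L2P u : L2 Omega u <->
  measurable_fun setT (ext u) /\ sqint mu (ext u) < +oo.
Proof.
rewrite /L2/= inE; split.
  move=> /andP[]; rewrite !inE/= => mu_ fu; split => //.
  rewrite -L2norm_sqr; move: fu; rewrite /finite_norm -/(L2norm Omega u) => fu.
  by rewrite lte_mul_pinfty ?Lnorm_ge0// ge0_fin_numE ?Lnorm_ge0.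
move=> [mu_ fu]; apply/andP; rewrite !inE/=; split => //.
rewrite /finite_norm -/(L2norm Omega u) ltey; apply/eqP => uy.
by move: fu; rewrite -L2norm_sqr uy expeS mulyy.
Qed.

Lemma L2cvgP (un : nat -> 'rV[R]_n -> R) u : L2cvg Omega un u <->
  forall e : R, (0 < e)%R -> exists N, forall k, (N <= k)%N ->
    sqint mu (ext (un k) \- ext u)%R <= e%:E.
Proof.
have bound k (e : R) : (0 < e)%R -> (L2norm Omega (un k \- u)%R <= e%:E) <->
    (sqint mu (ext (un k) \- ext u)%R <= (e ^+ 2)%:E).
  move=> e0; rewrite -extB -L2norm_sqr EFin_expe lee_sqr ?Lnorm_ge0//.
  by rewrite lee_fin ltW.
rewrite /L2cvg; split => [h e e0|h].
  have se0 : (0 < Num.sqrt e)%R by rewrite sqrtr_gt0.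
  have [fn fc] := (fine_cvgP _ _).1 h.
  have [N _ NP] := (cvgr0Pnorm_le _).1 fc _ se0.
  have [M _ MP] := fn.
  exists (maxn N M) => k; rewrite geq_max => /andP[Nk Mk].
  rewrite -(sqr_sqrtr (ltW e0)); apply/(bound k _ se0).
  rewrite -(fineK (MP k Mk)) lee_fin.
  exact: le_trans (ler_norm _) (NP k Nk).
apply/fine_cvgP; split.
  have [N NP] := h 1%R ltr01; exists N => // k /= Nk.
  rewrite ge0_fin_numE ?Lnorm_ge0//; apply: le_lt_trans (ltry 1%R).
  by apply/(bound k _ ltr01); rewrite expr1n; exact: NP.
apply/cvgr0Pnorm_le => e e0.
have [N NP] := h (e ^+ 2)%R (exprn_gt0 2 e0); exists N => // k /= Nk.
have := NP k Nk; move/(bound k _ e0) => le.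
rewrite ger0_norm ?fine_ge0 ?Lnorm_ge0// -lee_fin fineK//.
rewrite ge0_fin_numE ?Lnorm_ge0//.
exact: le_lt_trans le (ltry _).
Qed.

Lemma measurable_far_domain : measurable ((Omega `*` Omega) `\` @D1 R n).
Proof. by apply: measurableD; [exact: measurableX|exact: measurable_D1]. Qed.

Lemma riesz_ge0 a (p : 'rV[R]_n * 'rV[R]_n) : (0 <= riesz a p)%R.
Proof. exact: powR_ge0. Qed.

Lemma far_kernel_ge0 a p : (0 <= far_kernel a p)%R.
Proof. by rewrite mulr_ge0// riesz_ge0. Qed.

Lemma measurable_far_kernel a : measurable_fun setT (far_kernel a).
Proof.
apply: measurable_funM; last exact: measurable_riesz.
exact: measurable_indic measurable_far_domain.
Qed.

Lemma far_kernel_sym a x y : far_kernel a (x, y) = far_kernel a (y, x).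
Proof.
rewrite /far_kernel riesz_sym !indicE; congr ((_ : bool)%:R * _)%R.
by apply/idP/idP; rewrite !inE/= => -[[? ?] D]; split => //; move=> /D1_sym.
Qed.

Lemma rowint_near_kernel a x : (0 < a < n%:R)%R ->
  rowint mu (near_kernel a) x = (n%:R / a * fine (omega_d R n))%:E.
Proof.
by move=> an; rewrite /rowint integral_near_kernel// [RHS]EFinM fineK// omega_d_fin.
Qed.

Lemma riesz_far_le1 a (p : 'rV[R]_n * 'rV[R]_n) : (a <= n%:R)%R -> ~ D1 p ->
  (riesz a p <= 1)%R.
Proof.
move=> an /negP; rewrite -ltNge => z1.
rewrite -[leRHS](congr1 (fun f => f (a - n%:R)%R) (powR1 R)) /riesz.
rewrite -[X in (_ `^ X <= _)%R]opprB -[X in (_ <= _ `^ X)%R]opprB !powRN.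
rewrite lef_pV2 ?posrE ?powR_gt0//; last exact: lt_trans z1.
by apply: ge0_ler_powR; rewrite ?nnegrE ?subr_ge0// ltW// (lt_trans _ z1).
Qed.

Lemma far_kernel_le a p : (a <= n%:R)%R -> (far_kernel a p <= \1_Omega p.2)%R.
Proof.
move=> an; rewrite /far_kernel !indicE.
have [|] := boolP (p \in _); last by rewrite mul0r.
rewrite inE/= => -[[oa ob] D]; rewrite mul1r mem_set//.
exact: riesz_far_le1.
Qed.

Lemma rowint_far_kernel a x : (a <= n%:R)%R ->
  rowint mu (far_kernel a) x <= (fine (mu Omega))%:E.
Proof.
move=> an; rewrite fineK; last by rewrite ge0_fin_numE.
rewrite -(setIT Omega) -integral_indic//; apply: ge0_le_integral => //.
- by move=> y _; rewrite lee_fin far_kernel_ge0.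
- apply/measurable_EFinP.
  exact: (measurableT_comp (measurable_far_kernel a) (pair1_measurable x)).
- exact/measurable_EFinP/measurable_indic.
- by move=> y _; rewrite lee_fin; exact: far_kernel_le.
Qed.

Lemma G01E u : G01 Omega u = 2^-1%:E * energy mu (near_kernel 0) (ext u).
Proof.
rewrite /G01 /energy integral_mkcond; congr (_ * _).
apply: eq_integral => p _; rewrite patchE /near_kernel indicE.
case: ifPn => pD; last by rewrite !mul0r.
rewrite mul1r real_normK ?num_real// /riesz sub0r powR_invn ?enorm_ge0//.
by rewrite mulrC.
Qed.

Lemma J01E u : J01 Omega u = - bform mu (far_kernel 0) (ext u).
Proof.
rewrite /J01 /bform integral_mkcond; congr (- _).
apply: eq_integral => p _; rewrite patchE /far_kernel indicE.
case: ifPn => [|pD]; last by rewrite !mul0r.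
rewrite inE => -[[oa ob] D]; rewrite !patchE !mem_set//.
rewrite mul1r /riesz sub0r powR_invn ?enorm_ge0//.
by rewrite mulrC.
Qed.

Section fractional.
Variables (a : R) (u : 'rV[R]_n -> R).
Hypothesis an : (0 < a < n%:R)%R.
Hypothesis L2u : L2 Omega u.
Let w := ext u.
Let C := (n%:R / a * fine (omega_d R n))%R.

Lemma near_mass_ge0 : (0 <= C)%R.
Proof.
case/andP: an => a0 _.
by rewrite /C mulr_ge0 ?fine_ge0 ?measure_ge0// divr_ge0// ltW.
Qed.

(** The double integral is absolutely convergent, which allows both Fubini's
    theorem and the splitting at distance 1. *)
Lemma JalphaE : Jalpha Omega a u =
  - (bform mu (near_kernel a) w + bform mu (far_kernel a) w).
Proof.
have [mw w2] := (L2P u).1 L2u; case/andP: (an) => a0 an1.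
have in1 := integrable_bform (@near_kernel_ge0 R n a) (measurable_near_kernel a)
  (near_kernel_sym a) near_mass_ge0 _ mw w2.
have if1 := integrable_bform (@far_kernel_ge0 a) (measurable_far_kernel a)
  (far_kernel_sym a) (fine_ge0 (measure_ge0 mu Omega)) _ mw w2.
rewrite /bform -integralD//; last 2 first.
- by apply: in1 => x; rewrite rowint_near_kernel.
- by apply: if1 => x; apply: rowint_far_kernel; exact: ltW.
rewrite -integral12_prod_meas1; last first.
  apply: integrableD => //.
    by apply: in1 => x; rewrite rowint_near_kernel.
  by apply: if1 => x; apply: rowint_far_kernel; exact: ltW.
rewrite /Jalpha; congr (- _); rewrite integral_mkcond.
apply: eq_integral => x _; rewrite patchE /fubini_F.
case: ifPn => Ox; last first.
  rewrite integral0_eq// => y _ /=.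
  by rewrite /w !patchE (negbTE Ox) mul0r !mulr0 adde0.
rewrite [LHS]integral_mkcond. apply: eq_integral => y _; rewrite patchE /=.
case: ifPn => Oy; last first.
  by rewrite /w !patchE (negbTE Oy) !mulr0 adde0.
rewrite /w !patchE Ox Oy /near_kernel /far_kernel -EFinD; congr EFin.
rewrite -mulrDl -mulrDl.
have -> : (\1_(@D1 R n) (x, y) + \1_((Omega `*` Omega) `\` @D1 R n) (x, y) = 1 :> R)%R.
  rewrite !indicE in_setD in_setX /= Ox Oy /=.
  by case: (_ \in _); rewrite ?addr0 ?add0r.
by rewrite mul1r mulrC /riesz /= -powRN opprB.
Qed.

(** The renormalising term is the diagonal part of the near energy, as
    n omega / a is the mass of the rows of the near kernel. *)
Lemma Jhat_alphaE : Jhat_alpha Omega a u =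
  2^-1%:E * energy mu (near_kernel a) w - bform mu (far_kernel a) w.
Proof.
have [mw w2] := (L2P u).1 L2u; case/andP: (an) => a0 an1.
have rn x : rowint mu (near_kernel a) x <= C%:E by rewrite rowint_near_kernel.
have rf x : rowint mu (far_kernel a) x <= (fine (mu Omega))%:E.
  by apply: rowint_far_kernel; exact: ltW.
have bn := bform_fin_num (@near_kernel_ge0 R n a) (measurable_near_kernel a)
  (near_kernel_sym a) near_mass_ge0 rn mw w2.
have bf := bform_fin_num (@far_kernel_ge0 a) (measurable_far_kernel a)
  (far_kernel_sym a) (fine_ge0 (measure_ge0 mu Omega)) rf mw w2.
rewrite (energy_bform (@near_kernel_ge0 R n a) (measurable_near_kernel a)
  (near_kernel_sym a) near_mass_ge0 rn mw w2).
rewrite /Jhat_alpha JalphaE L2norm_sqr.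
have -> : \int[mu]_x ((w x ^+ 2)%:E * rowint mu (near_kernel a) x) =
    (n%:R / a)%:E * omega_d R n * sqint mu w.
  rewrite -[X in _ * X * _]fineK ?omega_d_fin// -EFinM -ge0_integralZl//.
  - apply: eq_integral => x _; rewrite rowint_near_kernel// muleC//.
  - exact: measurable_sqr.
  - by move=> x _; rewrite lee_fin sqr_ge0.
  - by rewrite lee_fin near_mass_ge0.
have : (n%:R / a)%:E * omega_d R n * sqint mu w \is a fin_num.
  by rewrite !fin_numM// ?omega_d_fin// ge0_fin_numE ?sqint_ge0.
rewrite -/w; move: bn bf.
move=> /fineK <- /fineK <- /fineK <-; rewrite -!EFinD.
by congr EFin; ring.
Qed.

End fractional.

End functionals_as_kernels.

(** * Vanishing exponent *)
Section vanishing_exponent.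
Context {R : realType} (n : nat).
Hypothesis n0 : (0 < n)%N.
Local Notation mu := (@lebesgue_row R n).
Local Open Scope ereal_scope.

(** At distance at most 1 a larger exponent gives a smaller power. *)
Lemma near_kernel_anti (a b : R) (p : 'rV[R]_n * 'rV[R]_n) : (a <= b)%R ->
  p.1 != p.2 -> (near_kernel b p <= near_kernel a p)%R.
Proof.
move=> ab pp; rewrite /near_kernel indicE.
have [|_] := boolP (p \in _); last by rewrite !mul0r.
rewrite inE => z1; rewrite !mul1r /riesz.
have z0 : (0 < enorm (p.1 - p.2))%R by exact: enorm_sub_gt0.
by apply: ger_powR; [rewrite z0|rewrite lerD2r].
Qed.

Lemma near_energy_anti (a b : R) (w : 'rV[R]_n -> R) : (a <= b)%R ->
  measurable_fun setT w ->
  energy mu (near_kernel b) w <= energy mu (near_kernel a) w.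
Proof.
move=> ab mw; apply: ge0_le_integral => //.
- by move=> p _; rewrite lee_fin mulr_ge0 ?near_kernel_ge0// sqr_ge0.
- by apply: measurable_energy => //; exact: measurable_near_kernel.
- by apply: measurable_energy => //; exact: measurable_near_kernel.
move=> p _; rewrite lee_fin; have [->|pp] := eqVneq p.1 p.2.
  by rewrite subrr expr0n/= !mulr0.
by apply: ler_wpM2r; rewrite ?sqr_ge0// near_kernel_anti.
Qed.

Variable alpha : nat -> R.
Hypothesis alpha_bounds : forall k, (0 < alpha k < n%:R)%R.
Hypothesis alpha_cvg0 : alpha k @[k --> \oo] --> (0:R)%R.

Lemma near_integrand_cvg (w : 'rV[R]_n -> R) p :
  (near_kernel (alpha k) p * (w p.1 - w p.2) ^+ 2)%:E @[k --> \oo] -->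
  (near_kernel 0 p * (w p.1 - w p.2) ^+ 2)%:E.
Proof.
apply: cvg_EFin; first exact: nearW.
have [->|pp] := eqVneq p.1 p.2.
  by rewrite subrr expr0n/= !mulr0; under eq_fun do rewrite mulr0; exact: cvg_cst.
apply: cvgM; last exact: cvg_cst.
apply: cvgM; first exact: cvg_cst.
have z0 : (0 < enorm (p.1 - p.2))%R by exact: enorm_sub_gt0.
apply: (powR_exponent_cvg z0); apply: cvgB => //; exact: cvg_cst.
Qed.

(** Dominated convergence, with the integrand of exponent 0 as a majorant. *)
Lemma near_energy_cvg (w : 'rV[R]_n -> R) : measurable_fun setT w ->
  energy mu (near_kernel 0) w < +oo ->
  energy mu (near_kernel (alpha k)) w @[k --> \oo] --> energy mu (near_kernel 0) w.
Proof.
move=> mw w0.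
have me a : measurable_fun setT
    (fun p => (near_kernel a p * (w p.1 - w p.2) ^+ 2)%:E).
  by apply: measurable_energy => //; exact: measurable_near_kernel.
have [] := @dominated_convergence _ _ _ (mu \x mu)%E setT measurableT
  (fun k p => (near_kernel (alpha k) p * (w p.1 - w p.2) ^+ 2)%:E)
  (fun p => (near_kernel 0 p * (w p.1 - w p.2) ^+ 2)%:E)
  (fun p => (near_kernel 0 p * (w p.1 - w p.2) ^+ 2)%:E) => //.
- by apply: aeW => p _; exact: near_integrand_cvg.
- apply/integrableP; split => //.
  rewrite (eq_integral (fun p => (near_kernel 0 p * (w p.1 - w p.2) ^+ 2)%:E))//.
  by move=> p _; rewrite gee0_abs// lee_fin mulr_ge0 ?near_kernel_ge0// sqr_ge0.
- apply: aeW => p k _; rewrite gee0_abs; last first.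
    by rewrite lee_fin mulr_ge0 ?near_kernel_ge0// sqr_ge0.
  rewrite lee_fin; have [->|pp] := eqVneq p.1 p.2; first by rewrite subrr expr0n/= !mulr0.
  apply: ler_wpM2r; rewrite ?sqr_ge0// near_kernel_anti//.
  by have /andP[/ltW] := alpha_bounds k.
Qed.

Lemma near_energy_fatou (w : 'rV[R]_n -> R) (E : \bar R) : measurable_fun setT w ->
  (forall k, energy mu (near_kernel (alpha k)) w <= E) ->
  energy mu (near_kernel 0) w <= E.
Proof.
move=> mw wE.
have me a : measurable_fun setT
    (fun p => (near_kernel a p * (w p.1 - w p.2) ^+ 2)%:E).
  by apply: measurable_energy => //; exact: measurable_near_kernel.
apply: (@le_trans _ _ (limn_einf (fun k => energy mu (near_kernel (alpha k)) w))).
  have -> : energy mu (near_kernel 0) w = \int[(mu \x mu)]_p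
      limn_einf (fun k => (near_kernel (alpha k) p * (w p.1 - w p.2) ^+ 2)%:E).
    apply: eq_integral => p _; apply/esym.
    by have [H _] := cvg_limn_einf_sup (@near_integrand_cvg w p).
  apply: (fatou (mu \x mu)%E measurableT (fun k => me (alpha k))) => k p _.
  by rewrite lee_fin mulr_ge0 ?near_kernel_ge0// sqr_ge0.
by apply: limn_einf_le_near; exact: nearW.
Qed.

Variable Omega : set 'rV[R]_n.
Hypothesis mOmega : measurable Omega.
Hypothesis finOmega : mu Omega < +oo.
Local Notation V := (fine (mu Omega)).

Lemma far_kernel_bform_fin (a : R) (w : 'rV[R]_n -> R) : (a <= n%:R)%R ->
  measurable_fun setT w -> sqint mu w < +oo ->
  bform mu (far_kernel Omega a) w \is a fin_num.
Proof.
move=> an mw w2.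
apply: (bform_fin_num (@far_kernel_ge0 _ _ Omega a)
  (measurable_far_kernel mOmega a) (far_kernel_sym Omega a)
  (fine_ge0 (measure_ge0 mu Omega)) _ mw w2) => x.
exact: rowint_far_kernel.
Qed.

(** At distance more than 1 the kernel is at most 1, so |w(x) w(y)| on
    Omega x Omega is an integrable majorant. *)
Lemma far_bform_cvg (w : 'rV[R]_n -> R) : measurable_fun setT w ->
  sqint mu w < +oo ->
  bform mu (far_kernel Omega (alpha k)) w @[k --> \oo] -->
  bform mu (far_kernel Omega 0) w.
Proof.
move=> mw w2.
have mb a : measurable_fun setT (fun p => (far_kernel Omega a p * (w p.1 * w p.2))%:E).
  by apply: measurable_bform => //; exact: measurable_far_kernel.
have [] := @dominated_convergence _ _ _ (mu \x mu)%E setT measurableT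
  (fun k p => (far_kernel Omega (alpha k) p * (w p.1 * w p.2))%:E)
  (fun p => (far_kernel Omega 0 p * (w p.1 * w p.2))%:E)
  (fun p => (\1_Omega p.1 * \1_Omega p.2 * `|w p.1 * w p.2|)%:E) => //.
- apply: aeW => p _; apply: cvg_EFin; first exact: nearW.
  apply: cvgM; last exact: cvg_cst.
  rewrite /far_kernel indicE; have [|_] := boolP (p \in _); last first.
    by rewrite mul0r; under eq_fun do rewrite mul0r; exact: cvg_cst.
  rewrite inE => -[_ /negP]; rewrite -ltNge => z1.
  apply: cvgM; first exact: cvg_cst.
  apply: (powR_exponent_cvg (lt_trans ltr01 z1)); apply: cvgB => //; exact: cvg_cst.
- have := cell_bform_integrable mOmega (_ : mu Omega = V%:E) mw w2.
  move=> /(_ _)/integrable_abse ; rewrite fineK ?ge0_fin_numE// => /(_ erefl).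
  apply: eq_integrable => // p _ /=.
  by rewrite normrM ger0_norm// mulr_ge0.
- apply: aeW => p k _; rewrite abse_EFin lee_fin normrM ger0_norm ?far_kernel_ge0//.
  apply: ler_wpM2r => //.
  rewrite /far_kernel !indicE; have [|_] := boolP (p \in _ `\` _); last first.
    by rewrite mul0r mulr_ge0.
  rewrite inE => -[[oa ob] D]; rewrite !mem_set// !mul1r.
  by apply: riesz_far_le1 => //; have /andP[_ /ltW] := alpha_bounds k.
Qed.

(** The modulus of continuity given by [bform_diff_le] is the same for all
    exponents, so it combines with the convergence for the fixed function v. *)
Lemma far_bform_diagonal_cvg (u : nat -> 'rV[R]_n -> R) (v : 'rV[R]_n -> R) :
  (forall k, measurable_fun setT (u k)) -> (forall k, sqint mu (u k) < +oo) ->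
  measurable_fun setT v -> sqint mu v < +oo ->
  (forall e : R, (0 < e)%R -> exists N, forall k, (N <= k)%N ->
     sqint mu (u k \- v)%R <= e%:E) ->
  bform mu (far_kernel Omega (alpha k)) (u k) @[k --> \oo] -->
  bform mu (far_kernel Omega 0) v.
Proof.
move=> mu_ u2 mv v2 uv.
have ak k : (alpha k <= n%:R)%R by have /andP[_ /ltW] := alpha_bounds k.
have f1 k : bform mu (far_kernel Omega (alpha k)) (u k) \is a fin_num.
  exact: far_kernel_bform_fin.
have f2 k : bform mu (far_kernel Omega (alpha k)) v \is a fin_num.
  exact: far_kernel_bform_fin.
have f0 : bform mu (far_kernel Omega 0) v \is a fin_num.
  by apply: far_kernel_bform_fin.
rewrite -(fineK f0); apply/fine_cvgP; split; first exact: nearW.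
suff d0 : (fine (bform mu (far_kernel Omega (alpha k)) (u k)) -
    fine (bform mu (far_kernel Omega (alpha k)) v))%R @[k --> \oo] --> (0:R)%R.
  have d1 : fine (bform mu (far_kernel Omega (alpha k)) v) @[k --> \oo] -->
      fine (bform mu (far_kernel Omega 0) v).
    by have := far_bform_cvg mv v2; rewrite -(fineK f0) => /fine_cvgP[].
  have := cvgD d0 d1; rewrite add0r => d2.
  rewrite (_ : fine \o _ = fun k =>
    (fine (bform mu (far_kernel Omega (alpha k)) (u k)) -
     fine (bform mu (far_kernel Omega (alpha k)) v) +
     fine (bform mu (far_kernel Omega (alpha k)) v))%R); last by apply/funext => k /=; rewrite subrK.
  exact: d2.
apply/cvgr0Pnorm_le => e e0.
have V0 : (0 <= V)%R by exact/fine_ge0/measure_ge0.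
pose s := fine (sqint mu v).
have s0 : (0 <= s)%R by exact/fine_ge0/sqint_ge0.
have sE : sqint mu v = s%:E by rewrite fineK// ge0_fin_numE// sqint_ge0.
pose P := (2 + 8 * s)%R.
have P0 : (0 < P)%R by rewrite /P; lra.
(* P bounds the squared norm of u k + v, and t and d make each of the two terms
   of bform_diff_le at most e / 2 *)
pose t := (e / (V * P + 1))%R.
have VP : (0 < V * P + 1)%R by rewrite ltr_wpDl// mulr_ge0// ltW.
have t0 : (0 < t)%R by rewrite divr_gt0.
pose d := Num.min 1%R (e * t / (V + 1))%R.
have V1 : (0 < V + 1)%R by lra.
have d0 : (0 < d)%R by rewrite lt_min ltr01 divr_gt0// mulr_gt0.
have [N NP] := uv d d0; exists N => // k /= Nk.
rewrite -lee_fin -abse_EFin EFinB !fineK//.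
have rf x : rowint mu (far_kernel Omega (alpha k)) x <= V%:E.
  exact: rowint_far_kernel.
apply: le_trans (bform_diff_le (@far_kernel_ge0 _ _ Omega _)
  (measurable_far_kernel mOmega _) (far_kernel_sym Omega _) V0 rf t0 (mu_ k) (u2 k) mv v2) _.
have S1 := NP k Nk.
have S1f : sqint mu (u k \- v)%R \is a fin_num.
  by rewrite ge0_fin_numE ?sqint_ge0//; apply: le_lt_trans S1 (ltry _).
have muv : measurable_fun setT (u k \- v)%R by exact: measurable_funB.
have S2 : sqint mu (u k \+ v)%R <= P%:E.
  have -> : (u k \+ v = (u k \- v) \+ (v \+ v))%R.
    by apply/funext => x /=; ring.
  apply: le_trans (sqintD_le mu muv (measurable_funD mv mv)) _.
  apply: (@le_trans _ _ (2%:E * 1%:E + 2%:E * (2%:E * s%:E + 2%:E * s%:E))).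
    apply: leeD; apply: lee_wpmul2l => //.
      by apply: le_trans S1 _; rewrite lee_fin /d ge_min lexx.
    by rewrite -sE; exact: sqintD_le.
  have -> : 2%:E * 1%:E + 2%:E * (2%:E * s%:E + 2%:E * s%:E) =
    (2 * 1 + 2 * (2 * s + 2 * s))%:E :> \bar R by [].
  by rewrite lee_fin /P; lra.
apply: (@le_trans _ _ ((V / 2 * t^-1)%:E * d%:E + (V / 2 * t)%:E * P%:E)).
  by apply: leeD; apply: lee_wpmul2l => //; rewrite lee_fin !mulr_ge0// ?invr_ge0 ltW.
rewrite -!EFinM -EFinD lee_fin.
have h1 : (V / 2 * t^-1 * d <= e / 2)%R.
  apply: (@le_trans _ _ (V / 2 * t^-1 * (e * t / (V + 1))))%R.
    by apply: ler_wpM2l; [rewrite !mulr_ge0// ?invr_ge0 ltW|rewrite /d ge_min lexx orbT].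
  rewrite [leLHS](_ : _ = e / 2 * (V / (V + 1)))%R; last first.
    by field; rewrite !gt_eqF.
  by rewrite ler_piMr ?divr_ge0 ?(ltW e0)// ler_pdivrMr// mul1r; lra.
have h2 : (V / 2 * t * P <= e / 2)%R.
  rewrite /t [leLHS](_ : _ = e / 2 * (V * P / (V * P + 1)))%R; last first.
    by field; rewrite gt_eqF.
  by rewrite ler_piMr ?divr_ge0 ?(ltW e0)// ler_pdivrMr// mul1r; lra.
lra.
Qed.

End vanishing_exponent.

(** * Gamma-convergence *)
Section gamma_convergence.
Context {R : realType} (d : nat).
Hypothesis d0 : (0 < d)%N.
Variable Omega : set 'rV[R]_d.
Hypothesis mOmega : measurable Omega.
Local Notation mu := (@lebesgue_row R d).
Hypothesis finOmega : (mu Omega < +oo)%E.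
Variable B : R.
Hypothesis B0 : 0 < B.
Hypothesis OmegaB : forall x, Omega x -> forall i, `|x ord0 i| < B.
Variable alpha : nat -> R.
Hypothesis alpha_bounds : forall k, 0 < alpha k < d%:R.
Hypothesis alpha_cvg0 : alpha k @[k --> \oo] --> (0:R).
Local Notation ext u := (u \_ Omega).
Local Notation V := (fine (mu Omega)).
Local Open Scope ereal_scope.

Let V0 : (0 <= V)%R. Proof. exact/fine_ge0/measure_ge0. Qed.

Let near_energy_ge0 (a : R) (w : 'rV[R]_d -> R) : 0 <= energy mu (near_kernel a) w.
Proof. by apply: energy_ge0 => p; exact: near_kernel_ge0. Qed.

Lemma near_energy_le k (w : 'rV[R]_d -> R) : measurable_fun setT w ->
  energy mu (near_kernel (alpha k)) w <=
    (4 * (d%:R / alpha k * fine (omega_d R d)))%:E * sqint mu w.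
Proof.
move=> mw; apply: energy_le_sqint => //.
- exact: near_kernel_ge0.
- exact: measurable_near_kernel.
- exact: near_kernel_sym.
- exact: near_mass_ge0.
- by move=> x; rewrite rowint_near_kernel.
Qed.

Lemma near_energy_fin k (w : 'rV[R]_d -> R) : measurable_fun setT w ->
  sqint mu w < +oo -> energy mu (near_kernel (alpha k)) w \is a fin_num.
Proof.
move=> mw w2; rewrite ge0_fin_numE//; apply: le_lt_trans (near_energy_le k mw) _.
by rewrite lte_mul_pinfty// lee_fin mulr_ge0// near_mass_ge0.
Qed.

Lemma H00P v : H00 Omega v ->
  [/\ measurable_fun setT (ext v), sqint mu (ext v) < +oo &
    energy mu (near_kernel 0) (ext v) < +oo].
Proof.
move=> [/(L2P Omega) [mv v2]]; rewrite G01E => Gv; split => //.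
rewrite ltey; apply/eqP => Ey; move: Gv; rewrite Ey mulry gtr0_sg ?invr_gt0//.
by rewrite mul1e ltxx.
Qed.

Lemma gamma_limsup v : H00 Omega v ->
  Jhat_alpha Omega (alpha k) v @[k --> \oo] --> Jhat0 Omega v.
Proof.
move=> Hv; have [mv v2 Ev] := H00P Hv; have L2v := Hv.1.
have f0 : bform mu (far_kernel Omega 0) (ext v) \is a fin_num.
  by apply: far_kernel_bform_fin.
rewrite (_ : (fun k => _) = fun k => 2^-1%:E * energy mu (near_kernel (alpha k)) (ext v)
   - bform mu (far_kernel Omega (alpha k)) (ext v)); last first.
  by apply/funext => k; rewrite Jhat_alphaE.
rewrite /Jhat0 G01E J01E.
apply: cvgeB.
- by rewrite fin_num_adde_defl// fin_numN.
- by apply: cvgeZl => //; exact: near_energy_cvg.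
- exact: far_bform_cvg.
Qed.

(** The exponent is first frozen at an index k0 for which the near energy of v
    is within e / 4 of its limit. *)
Lemma gamma_liminf v (u : nat -> 'rV[R]_d -> R) :
  H00 Omega v -> (forall k, L2 Omega (u k)) -> L2cvg Omega u v ->
  Jhat0 Omega v <= limn_einf (fun k => Jhat_alpha Omega (alpha k) (u k)).
Proof.
move=> Hv L2u /(L2cvgP Omega) uv; have [mv v2 Ev] := H00P Hv.
have mu_ k : measurable_fun setT (ext (u k)) by have [] := (L2P Omega (u k)).1 (L2u k).
have u2 k : sqint mu (ext (u k)) < +oo by have [] := (L2P Omega (u k)).1 (L2u k).
have fG : energy mu (near_kernel 0) (ext v) \is a fin_num by rewrite ge0_fin_numE.
have fb : bform mu (far_kernel Omega 0) (ext v) \is a fin_num.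
  by apply: far_kernel_bform_fin.
pose G := fine (energy mu (near_kernel 0) (ext v)).
have G0 : (0 <= G)%R by exact: fine_ge0.
apply/lee_subgt0Pr => e e0.
apply: limn_einf_ge_near.
pose t := (e / (4 * (G + 1)))%R.
have t0 : (0 < t)%R by rewrite divr_gt0// mulr_gt0//; lra.
have tG : (t * G <= e / 4)%R.
  rewrite /t [leLHS](_ : _ = e / 4 * (G / (G + 1)))%R; last first.
    by field; rewrite gt_eqF//; lra.
  rewrite ler_piMr; [by []|lra|].
  by rewrite ler_pdivrMr; lra.
have [k0 k0P] : exists k0, (G - e / 4)%:E <= energy mu (near_kernel (alpha k0)) (ext v).
  have := near_energy_cvg alpha_bounds alpha_cvg0 mv Ev.
  rewrite -(fineK fG) => /fine_cvgP[_ /cvgr_ge/(_ (G - e / 4)%R)] [|k0 _ kP].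
    by rewrite -/G; lra.
  exists k0; rewrite -(fineK (near_energy_fin k0 mv v2)) lee_fin.
  exact: (kP k0 (leqnn _)).
have [a0 ad] := andP (alpha_bounds k0).
pose C := (4 * (d%:R / alpha k0 * fine (omega_d R d)))%R.
have C0 : (0 <= C)%R by rewrite mulr_ge0// near_mass_ge0.
pose s := (e / (4 * ((1 + t^-1) * C + 1)))%R.
have D0 : (0 <= (1 + t^-1) * C)%R by rewrite mulr_ge0// addr_ge0// invr_ge0 ltW.
have s0 : (0 < s)%R by rewrite divr_gt0// mulr_gt0//; lra.
have sC : ((1 + t^-1) * C * s <= e / 4)%R.
  rewrite /s; set D := ((1 + t^-1) * C)%R in D0 *.
  rewrite [leLHS](_ : _ = e / 4 * (D / (D + 1)))%R; last first.
    by field; rewrite gt_eqF//; lra.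
  rewrite ler_piMr; [by []|lra|].
  by rewrite ler_pdivrMr; lra.
have [N1 N1P] := uv s s0.
have [N2 _ N2P] : \forall k \near \oo, (alpha k <= alpha k0)%R.
  have := alpha_cvg0; move=> /cvgr_le; apply; exact: a0.
have bcv := far_bform_diagonal_cvg alpha_bounds alpha_cvg0 mOmega finOmega mu_ u2 mv v2 uv.
have [N3 _ N3P] : \forall k \near \oo,
    (fine (bform mu (far_kernel Omega (alpha k)) (ext (u k))) <=
     fine (bform mu (far_kernel Omega 0) (ext v)) + e / 2)%R.
  move: bcv; rewrite -(fineK fb) => /fine_cvgP[_ /cvgr_le]; apply.
  by rewrite ltrDl; lra.
exists (maxn N1 (maxn N2 N3)) => // k /=.
rewrite !geq_max => /and3P[k1 k2 k3].
have fb' : bform mu (far_kernel Omega (alpha k)) (ext (u k)) \is a fin_num.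
  by apply: far_kernel_bform_fin => //; have /andP[_ /ltW] := alpha_bounds k.
have fE := near_energy_fin k (mu_ k) (u2 k).
pose E := fine (energy mu (near_kernel (alpha k)) (ext (u k))).
have hE : (G - e / 4 <= E + t * E + e / 4)%R.
  rewrite -lee_fin; apply: le_trans k0P _.
  apply: le_trans (energy_split mu (@near_kernel_ge0 R d (alpha k0))
     (measurable_near_kernel (alpha k0)) t0 mv (mu_ k)) _.
  rewrite [leRHS](_ : _ = (1 + t)%:E * E%:E + (e / 4)%:E); last first.
    by rewrite -EFinM -EFinD; congr EFin; ring.
  apply: leeD.
    apply: lee_wpmul2l; first by rewrite lee_fin; lra.
    rewrite /E fineK//; apply: near_energy_anti => //; exact: N2P.
  have mvu : measurable_fun setT (ext v \- ext (u k))%R by exact: measurable_funB.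
  apply: (@le_trans _ _ ((1 + t^-1)%:E * (C%:E * s%:E))).
    apply: lee_wpmul2l; first by rewrite lee_fin addr_ge0// invr_ge0 ltW.
    apply: le_trans (near_energy_le k0 mvu) _.
    apply: lee_wpmul2l => //.
    rewrite (_ : sqint mu (ext v \- ext (u k))%R = sqint mu (ext (u k) \- ext v)%R).
      exact: N1P.
    apply: eq_integral => x _ /=; congr EFin.
    by rewrite -sqrrN opprB.
  by rewrite -!EFinM lee_fin mulrA.
(* if E exceeds G there is nothing to prove, otherwise t E <= t G <= e / 4 *)
have hE' : (G - e <= E)%R.
  have [GE|EG] := leP G E; first lra.
  have : (t * E <= t * G)%R by rewrite ler_pM2l// ltW.
  lra.
rewrite Jhat_alphaE// /Jhat0 G01E J01E.
rewrite -(fineK fG) -(fineK fb) -(fineK fb') -(fineK fE) -/G -/E.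
have := N3P k k3 => /=.
set b0 := fine (bform _ _ (ext v)); set b1 := fine _ => hb.
suff : ((2^-1 * G - b0 - e) <= 2^-1 * E - b1)%R by rewrite -lee_fin.
lra.
Qed.

(** The far term is at most |Omega| times the squared norm, so the hypothesis
    bounds the norms and the near energies separately. The limit v has bounded
    near energy for each fixed exponent alpha k, by comparison with a late term of
    the subsequence, hence for exponent 0. *)
Lemma gamma_compactness (u : nat -> 'rV[R]_d -> R) (m M : R) :
  (0 < m)%R -> (0 < M)%R -> (forall k, L2 Omega (u k)) ->
  (forall k, Jhat_alpha Omega (alpha k) (u k) +
     (mu Omega + m%:E) * L2norm Omega (u k) ^+ 2 <= M%:E) ->
  exists (k : nat -> nat) (v : 'rV[R]_d -> R),
    [/\ {homo k : i j / (i < j)%N}, H00 Omega v & L2cvg Omega (fun i => u (k i)) v].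
Proof.
move=> m0 M0 L2u Hu.
have mu_ k : measurable_fun setT (ext (u k)) by have [] := (L2P Omega (u k)).1 (L2u k).
have u2 k : sqint mu (ext (u k)) < +oo by have [] := (L2P Omega (u k)).1 (L2u k).
have ak k : (alpha k <= d%:R)%R by have /andP[_ /ltW] := alpha_bounds k.
have bounds k : sqint mu (ext (u k)) <= (M / m)%:E /\
    energy mu (near_kernel (alpha k)) (ext (u k)) <= (2 * M)%:E.
  have fE := near_energy_fin k (mu_ k) (u2 k).
  have fs : sqint mu (ext (u k)) \is a fin_num by rewrite ge0_fin_numE// sqint_ge0.
  have fb : bform mu (far_kernel Omega (alpha k)) (ext (u k)) \is a fin_num.
    exact: far_kernel_bform_fin.
  have rf x : rowint mu (far_kernel Omega (alpha k)) x <= V%:E.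
    exact: rowint_far_kernel.
  have ab := abs_bform_le (@far_kernel_ge0 _ _ Omega _)
    (measurable_far_kernel mOmega _) (far_kernel_sym Omega _) V0 rf (mu_ k) (u2 k).
  have := Hu k; rewrite Jhat_alphaE// L2norm_sqr.
  have fO : mu Omega \is a fin_num by rewrite ge0_fin_numE.
  move: ab; rewrite -(fineK fb) -(fineK fs) -(fineK fE) -(fineK fO) /=.
  have := near_energy_ge0 (alpha k) (ext (u k)); have := sqint_ge0 mu (ext (u k)).
  rewrite -(fineK fs) -(fineK fE).
  set s := fine (sqint _ _); set b := fine (bform _ _ _); set E := fine (energy _ _ _).
  rewrite !lee_fin => s0 E0 hb h.
  have {}h : (2^-1 * E - b + (V + m) * s <= M)%R by rewrite -lee_fin.
  have hb' := le_trans (ler_norm _) hb.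
  move: s0 E0 hb' h => /= {hb}; move: s E b (fine (mu Omega)) => s E b W s0 E0 hb' h.
  by split; [rewrite ler_pdivlMr//|]; nra.
have uB k x : (ext (u k)) x != 0%R -> forall i, (`|x ord0 i| < B)%R.
  move=> ux; apply: OmegaB; apply: contrapT => Ox.
  by rewrite ext_out// eqxx in ux.
have ab01 k : (0 <= alpha k <= d%:R)%R by rewrite ak andbT; have /andP[/ltW] := alpha_bounds k.
have [phi [phimon cau]] := sqint_cauchy_subsequence d0 B0 ab01 alpha_cvg0 mu_ uB
  (fun k => (bounds k).1) (fun k => (bounds k).2).
have [v [mv v_out vlim]] := sqint_complete (mu := mu) mOmega finOmega
  (fun k => mu_ (phi k)) (fun k x Ox => @ext_out _ _ Omega (u (phi k)) x Ox) cau.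
have extv : ext v = v.
  apply/funext => x; rewrite patchE; case: ifPn => // /negP xO.
  by rewrite v_out// => Ox; apply: xO; rewrite inE.
have v2 : sqint mu v < +oo.
  have [N NP] := vlim 1%R ltr01.
  rewrite (_ : v = ext (u (phi N)) \- (ext (u (phi N)) \- v))%R; last first.
    by apply/funext => x /=; ring.
  apply: le_lt_trans (sqintB_le mu (mu_ _) (measurable_funB (mu_ _) mv)) _.
  rewrite lte_add_pinfty// lte_mul_pinfty//.
  exact: le_lt_trans (NP N (leqnn N)) (ltry _).
exists phi, v; split => //; last by apply/(L2cvgP Omega); rewrite extv.
have phi_ge k : (k <= phi k)%N.
  by elim: k => // k IH; apply: leq_ltn_trans IH (phimon _ _ _).
split; first by apply/(L2P Omega); rewrite extv.
rewrite G01E extv.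
suff Ev : energy mu (near_kernel 0) v <= (4 * M + 1)%:E.
  apply: lte_mul_pinfty; [by rewrite lee_fin|by []|].
  exact: le_lt_trans Ev (ltry _).
apply: (near_energy_fatou alpha_cvg0) => // k.
pose C := (4 * (d%:R / alpha k * fine (omega_d R d)))%R.
have C0 : (0 <= C)%R by rewrite mulr_ge0// near_mass_ge0.
have s0 : (0 < (2 * C + 1)^-1)%R by rewrite invr_gt0; lra.
have [N1 N1P] := vlim _ s0.
have [a0 ad] := andP (alpha_bounds k).
have [N2 _ N2P] : \forall l \near \oo, (alpha l <= alpha k)%R.
  have := alpha_cvg0; move=> /cvgr_le; apply; exact: a0.
pose l := maxn N1 N2.
pose w := ext (u (phi l)).
have mwv : measurable_fun setT (w \- v)%R by apply: measurable_funB => //; exact: mu_.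
rewrite (_ : v = w \- (w \- v))%R; last by apply/funext => x /=; ring.
apply: le_trans (energyB_le mu (@near_kernel_ge0 R d (alpha k))
  (measurable_near_kernel (alpha k)) (mu_ _) mwv) _.
rewrite (_ : 4 * M + 1 = 2 * (2 * M) + 1)%R; last by ring.
rewrite [leRHS]EFinD; apply: leeD.
  rewrite [leRHS]EFinM; apply: lee_wpmul2l => //.
  apply: le_trans (bounds (phi l)).2; apply: near_energy_anti => //.
  by apply: N2P => /=; apply: leq_trans (phi_ge l); rewrite leq_maxr.
apply: (@le_trans _ _ (2%:E * (C%:E * ((2 * C + 1)^-1)%:E))).
  apply: lee_wpmul2l => //; apply: le_trans (near_energy_le k mwv) _.
  by apply: lee_wpmul2l => //; apply: N1P; rewrite leq_maxl.
rewrite -!EFinM lee_fin mulrA ler_pdivrMr ?mul1r; lra.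
Qed.

End gamma_convergence.

Unset Implicit Arguments.

Theorem theorem2p3 (R : realType) (d : nat) (d_ge1 : (1 <= d)%N)
    (Omega : set 'rV[R]_d) (Omega_open : open Omega)
    (Omega_bounded : bounded_set Omega)
    (Omega_lipschitz : lipschitz_boundary Omega)
    (alpha : nat -> R) (alpha_bounds : forall n, 0 < alpha n < d%:R)
    (alpha_cvg0 : alpha n @[n --> \oo] --> 0) :
  [/\ (* compactness *)
      forall (u : nat -> 'rV[R]_d -> R) (m M : R), 0 < m -> 0 < M ->
        (forall n, L2 Omega (u n)) ->
        (forall n, (Jhat_alpha Omega (alpha n) (u n)
                    + (lebesgue_row d Omega + m%:E) * L2norm Omega (u n) ^+ 2
                    <= M%:E)%E) ->
        exists (k : nat -> nat) (v : 'rV[R]_d -> R),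
          [/\ {homo k : i j / (i < j)%N}, H00 Omega v &
              L2cvg Omega (fun n => u (k n)) v],
      (* Gamma-liminf inequality *)
      forall (v : 'rV[R]_d -> R) (u : nat -> 'rV[R]_d -> R),
        H00 Omega v -> (forall n, L2 Omega (u n)) -> L2cvg Omega u v ->
        (Jhat0 Omega v
          <= limn_einf (fun n => Jhat_alpha Omega (alpha n) (u n)))%E &
      (* Gamma-limsup inequality *)
      forall v : 'rV[R]_d -> R, H00 Omega v ->
        exists u : nat -> 'rV[R]_d -> R,
          [/\ forall n, L2 Omega (u n), L2cvg Omega u v &
              Jhat_alpha Omega (alpha n) (u n) @[n --> \oo]
                --> Jhat0 Omega v]].
Proof.
have mO := open_measurable_row Omega_open.
have fO := lebesgue_row_bounded Omega_bounded mO.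
have [B [B0 OB]] := bounded_coord Omega_bounded.
split.
- by move=> u m M; exact: (gamma_compactness d_ge1 mO fO B0 OB).
- by move=> v u; exact: gamma_liminf.
- move=> v Hv; exists (fun=> v); split; [by move=> _; exact: Hv.1| |].
    apply/(L2cvgP Omega) => e e0; exists 0%N => k _.
    rewrite (_ : sqint _ _ = 0%E) ?lee_fin ?ltW//.
    by apply: integral0_eq => x _ /=; rewrite subrr expr0n.
  exact: gamma_limsup.
Qed.
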